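(* Let $P \subseteq \mathbb{R}^d$ be a $d$-dimensional spanning lattice polytope, and let $h^*_P(t)=\sum_{i=0}^{d} h^*_i t^i$ be its $h^*$-polynomial, of degree $s=\deg(P)$. Then $h^*_i \ge 1$ for all $i = 0, 1, \ldots, \deg(P)$.
   Context: A lattice polytope $P\subseteq\mathbb{R}^d$ is the convex hull of finitely many points of $\mathbb{Z}^d$. Its Ehrhart polynomial is $\mathrm{ehr}_P(k)=|kP\cap\mathbb{Z}^d|$, and the $h^*$-polynomial $h^*_P(t)\in\mathbb{Z}_{\ge 0}[t]$ is defined by $\sum_{k\ge 0}\mathrm{ehr}_P(k)t^k = h^*_P(t)/(1-t)^{d+1}$ for $d$-dimensional $P$; its coefficients are denoted $h^*_0,\dots,h^*_d$ and its degree $s\in\{0,\dots,d\}$ is called the degree $\deg(P)$ of $P$. A $d$-dimensional lattice polytope $P\subseteq\mathbb{R}^d$ is called spanning if every point of $\mathbb{Z}^d$ is an affine integer combination of the lattice points in $P$. *)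

(* Defs.v *)
From HB Require Import structures.
From mathcomp Require Import all_boot all_order all_algebra finmap.
From mathcomp Require Import boolp classical_sets functions cardinality reals.

Set Implicit Arguments.
Unset Strict Implicit.
Unset Printing Implicit Defensive.

Import Order.TTheory GRing.Theory Num.Theory.

Local Open Scope classical_set_scope.
Local Open Scope ring_scope.

(* Used both over the reals and over int, where it consists of the affine
   integer combinations of points of A. *)
Definition affine_hull (K : nzRingType) (d : nat) (A : set 'rV[K]_d) :
    set 'rV[K]_d :=
  [set x | exists (n : nat) (p : 'I_n -> 'rV[K]_d) (a : 'I_n -> K),
     [/\ forall i, A (p i), \sum_(i < n) a i = 1 &
         x = \sum_(i < n) a i *: p i]].

Definition convex_hull (R : realType) (d : nat) (A : set 'rV[R]_d) :
    set 'rV[R]_d :=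
  [set x | exists (n : nat) (p : 'I_n -> 'rV[R]_d) (a : 'I_n -> R),
     [/\ forall i, A (p i), forall i, 0 <= a i, \sum_(i < n) a i = 1 &
         x = \sum_(i < n) a i *: p i]].

Definition of_lattice (R : realType) (d : nat) (z : 'rV[int]_d) : 'rV[R]_d :=
  map_mx intr z.

Definition lattice_points (R : realType) (d : nat) (A : set 'rV[R]_d) :
    set 'rV[int]_d :=
  [set z | A (of_lattice R z)].

Definition lattice_polytope (R : realType) (d : nat) (P : set 'rV[R]_d) : Prop :=
  exists V : set 'rV[int]_d,
    finite_set V /\ P = convex_hull [set of_lattice R v | v in V].

(* The dimension of P is that of its affine hull, and the only d-dimensional
   affine subspace of R^d is R^d itself (the empty set is excluded even when
   d = 0). *)
Definition full_dimensional (R : realType) (d : nat) (P : set 'rV[R]_d) : Prop :=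
  affine_hull P = [set: 'rV[R]_d].

Definition spanning (R : realType) (d : nat) (P : set 'rV[R]_d) : Prop :=
  affine_hull (lattice_points P) = [set: 'rV[int]_d].

Definition dilate (R : realType) (d : nat) (k : nat) (P : set 'rV[R]_d) :
    set 'rV[R]_d :=
  [set k%:R *: x | x in P].

(* fset_set returns the empty set on infinite sets; this never happens for
   polytopes, which are bounded. *)
Definition ehrhart (R : realType) (d : nat) (P : set 'rV[R]_d) (k : nat) : nat :=
  #|` fset_set (lattice_points (dilate k P))|%fset.

(* h(t) = (1 - t)^(d+1) * \sum_k ehrhart P k t^k as formal power series,
   coefficient by coefficient; this determines h. *)
Definition is_hstar (R : realType) (d : nat) (P : set 'rV[R]_d)
    (h : {poly int}) : Prop :=
  forall n : nat,
    h`_n = \sum_(j < n.+1)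
             (((1 - 'X) ^+ d.+1 : {poly int})`_j * (ehrhart P (n - j))%:R).

(* Main.v *)
(* Let C be the monoid of lattice points of the cone over P, K an algebraically
   closed field of characteristic 2 and A = K[C], graded by height.  Noether
   normalization gives d + 1 elements theta of degree one such that A is finite
   over T = K[theta].  A is a free T-module (Hochster): if c A lies in a free
   T-submodule of A, then for large q = 2^r a relation among homogeneous lifts of
   a basis of A / theta A gives an element e of their span with c e^q in
   (theta_i^q) A, and the splitting of the r-th Frobenius that sends c to 1 shows
   that e lies in theta A.  Hence h*_j = dim (A / theta A)_j.

   If h*_m = 0 with m >= 1, then A_m = theta A_(m-1), so the T-module generated
   by A_(m-1) is stable under multiplication by A_1.  As P is spanning, a
   translate of C lies in the monoid generated by the elements of height one, so
   this module contains a translate of A.  It has full rank, but is generated by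
   h*_0 + ... + h*_(m-1) elements, hence h*_j = 0 for all j >= m. *)

Require Import Defs.
From mathcomp Require Import all_boot all_order all_algebra.
From mathcomp Require Import closed_field mpoly finmap.
From mathcomp Require Import boolp classical_sets cardinality reals.
From mathcomp Require Import zify ring.

Set Implicit Arguments.
Unset Strict Implicit.
Unset Printing Implicit Defensive.

Import Order.TTheory GRing.Theory Num.Theory.

Local Open Scope ring_scope.

(** * Linear algebra, growth and numerators *)

(** Everything is reduced to supports and dimension counts: [A] is not a type of its own but the set
    of polynomials supported in [C], and freeness over [T] reads as linear independence, degree by
    degree, of the products of monomials in theta with the lifted basis. Generation alone only
    bounds the Hilbert function from above; independence is what identifies the quotient dimensions
    with the h* coefficients. The field is used twice: it has enough points for a linear change of
    parameters to avoid the zeros of a relation, and unique q-th roots, from which a splitting of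
    the Frobenius is built. The multiplier c is fixed before q is chosen, so one c serves all q. The
    splitting takes values in the ambient polynomial ring, possibly outside [A]; large q repairs
    this, because for z of fixed height and w in C, membership of w + q z in C then forces z into C.
    A gap is contradicted by growth, since translation by a fixed monomial does not affect the
    leading coefficient of a Hilbert function. *)

Lemma indep_span_leq (K : fieldType) (V : lmodType K) (T U : eqType)
    (s : seq T) (t : seq U) (b : T -> V) (c : U -> V) :
  uniq s ->
  (forall a : T -> K, \sum_(x <- s) a x *: b x = 0 ->
     forall x, x \in s -> a x = 0) ->
  (forall x, x \in s -> exists a : U -> K, b x = \sum_(y <- t) a y *: c y) ->
  (size s <= size t)%N.
Proof.
move=> us ind spn; rewrite leqNgt; apply/negP => lt_ts.
have /choice[a aP] : forall x, exists a : U -> K,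
    x \in s -> b x = \sum_(y <- t) a y *: c y.
  move=> x; case: (boolP (x \in s)) => [/spn[a Ea]|_]; first by exists a.
  by exists (fun _ => 0).
pose A := \matrix_(i < size s, j < size t)
  a (tnth (in_tuple s) i) (tnth (in_tuple t) j).
have kA0 : kermx A != 0.
  rewrite -mxrank_eq0 mxrank_ker -lt0n subn_gt0.
  exact: leq_ltn_trans (rank_leq_col A) lt_ts.
pose u := nz_row (kermx A).
have u0 : u != 0 by rewrite nz_row_eq0.
have uA : u *m A = 0 by apply/sub_kermxP; exact: nz_row_sub.
pose a' x := if insub (index x s) is Some i then u 0 i else 0.
have a'E i : a' (tnth (in_tuple s) i) = u 0 i.
  rewrite /a' (tnth_nth (tnth (in_tuple s) i)) /= index_uniq //.
  by rewrite valK.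
have /ind a'0 : \sum_(x <- s) a' x *: b x = 0.
  rewrite big_tnth.
  under eq_bigr => i _ do
    rewrite a'E (aP _ (mem_tnth i (in_tuple s))) big_tnth scaler_sumr.
  rewrite exchange_big big1 //= => j _.
  under eq_bigr => i _ do rewrite scalerA.
  rewrite -scaler_suml; have /matrixP/(_ 0 j) := uA.
  rewrite !mxE => Ej; rewrite (_ : \sum_i _ = 0) ?scale0r // -[RHS]Ej.
  by apply: eq_bigr => i _; rewrite mxE.
move/eqP: u0; apply; apply/rowP => i.
by rewrite mxE -a'E a'0 // mem_tnth.
Qed.

Lemma leq_wexp2r (m n e : nat) : (m <= n -> m ^ e <= n ^ e)%N.
Proof. by case: e => // e; rewrite leq_exp2r. Qed.

Lemma leq_bin_exp (k d : nat) : ('C(k + d, d) <= k.+1 ^ d)%N.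
Proof.
elim: d => [|d IH]; first by rewrite bin0.
have := mul_bin_diag (k + d).+1 d; rewrite /= => E.
have : (d.+1 * 'C((k + d).+1, d.+1) <= d.+1 * (k.+1 * k.+1 ^ d))%N.
  rewrite -E mulnA; apply: leq_mul => //.
  by rewrite mulnS mulSn; nia.
by rewrite leq_pmul2l // addnS expnS.
Qed.

Lemma exp_leq_bin (k d : nat) : (k.+1 ^ d <= d`! * 'C(k + d, d))%N.
Proof.
elim: d => [|d IH]; first by rewrite bin0.
have := mul_bin_diag (k + d).+1 d; rewrite /= => E.
rewrite addnS factS mulnAC -E expnS -mulnA.
by apply: leq_mul; [lia | rewrite mulnC].
Qed.

Lemma bin_not_bounded (d A M : nat) :
  ~ (forall k, 'C(k + d.+1, d.+1) <= A * (M * k.+1) ^ d)%N.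
Proof.
(* At [k = B] the lower bound [exp_leq_bin] would give [B.+1 ^ d.+1 <= B * B.+1 ^ d]. *)
pose B := (d.+1`! * (A * M ^ d))%N.
move=> /(_ B) le_B; have := exp_leq_bin B d.+1.
move/leq_trans/(_ (leq_mul (leqnn _) le_B)).
rewrite (_ : d.+1`! * _ = B * B.+1 ^ d)%N; last by rewrite expnMn /B !mulnA.
by rewrite expnS leq_pmul2r ?expn_gt0 // ltnn.
Qed.

Lemma nondecreasing_subseq (f : nat -> nat) :
  exists phi : nat -> nat, (forall n, phi n < phi n.+1)%N /\
    (forall m n, m <= n -> f (phi m) <= f (phi n))%N.
Proof.
have /choice[psi psiP] : forall N, exists i, (N <= i)%N /\
    forall j, (N <= j)%N -> (f i <= f j)%N.
  move=> N; have exv : exists v, `[< exists2 i, (N <= i)%N & f i = v >].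
    by exists (f N); apply/asboolP; exists N.
  case: (ex_minnP exv) => v /asboolP[i le_Ni <-] vmin.
  by exists i; split=> // j le_Nj; apply: vmin; apply/asboolP; exists j.
pose phi := fix phi n := if n is n'.+1 then psi (phi n').+1 else psi 0%N.
have phiS n : (phi n < phi n.+1)%N by have [] := psiP (phi n).+1.
exists phi; split=> // m n le_mn.
have ge_phi : (phi m <= phi n)%N.
  elim: n le_mn => [|n IH]; first by rewrite leqn0 => /eqP->.
  rewrite leq_eqVlt => /orP[/eqP->//|]; rewrite ltnS => /IH.
  by move/leq_trans; apply; apply: ltnW.
case: m le_mn ge_phi => [|m] le_mn ge_phi; first by have [_] := psiP 0%N; apply.
by have [_] := psiP (phi m).+1; apply; apply: leq_trans ge_phi; apply: phiS.
Qed.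

(** Dickson's lemma for a sequence of vectors: a subsequence is extracted once per coordinate, and
    passing to a further one keeps the earlier coordinates nondecreasing. *)
Lemma nondecreasing_subseqs (I : finType) (f : I -> nat -> nat) :
  exists phi : nat -> nat, (forall n, phi n < phi n.+1)%N /\
    (forall i m n, m <= n -> f i (phi m) <= f i (phi n))%N.
Proof.
suff [phi [phiS phiP]] : exists phi : nat -> nat,
    (forall n, phi n < phi n.+1)%N /\ forall i, i \in enum I ->
      forall m n, (m <= n)%N -> (f i (phi m) <= f i (phi n))%N.
  by exists phi; split=> // i; apply: phiP; rewrite mem_enum.
elim: (enum I) => [|j s [phi [phiS phiP]]]; first by exists id.
have [psi [psiS psiP]] := nondecreasing_subseq (f j \o phi).
have phi_lt a b : (a < b -> phi a < phi b)%N.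
  elim: b => // b IH; rewrite ltnS leq_eqVlt => /orP[/eqP->//|/IH].
  by move/ltn_trans; apply.
have psi_le a b : (a <= b -> psi a <= psi b)%N.
  elim: b => [|b IH]; first by rewrite leqn0 => /eqP->.
  rewrite leq_eqVlt => /orP[/eqP->//|]; rewrite ltnS => /IH.
  by move/leq_trans; apply; apply: ltnW.
exists (phi \o psi); split=> [n|i]; first exact: phi_lt.
rewrite inE => /orP[/eqP->|i_s] m n le_mn; first exact: psiP.
by apply: phiP => //; apply: psi_le.
Qed.

Lemma eq_coefM (R : comNzRingType) (r p q : {poly R}) (n : nat) :
  (forall i, (i <= n)%N -> p`_i = q`_i) -> (r * p)`_n = (r * q)`_n.
Proof.
move=> Epq; rewrite !coefM; apply: eq_bigr => i _.
by rewrite Epq // leq_subr.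
Qed.

(** The expansion of 1 / (1 - t)^(d+1), cut off at [N], which leaves the coefficients below [N]
    intact. The induction on [d] is Pascal's rule. *)
Lemma coef_1subX_bin (d N n : nat) : (n < N)%N ->
  ((1 - 'X) ^+ d.+1 * \poly_(i < N) ('C(i + d, d))%:R : {poly int})`_n
    = (n == 0%N)%:R.
Proof.
elim: d n => [|d IH] n lt_nN.
  rewrite expr1 mulrBl mul1r coefB coefXM !coef_poly lt_nN bin0.
  by case: n lt_nN => [|n] // lt_nN; rewrite /= bin0 ltnW // subrr.
rewrite -IH // exprSr -mulrA; apply: eq_coefM => i le_in.
have lt_iN : (i < N)%N by apply: leq_ltn_trans lt_nN.
rewrite mulrBl mul1r coefB coefXM !coef_poly lt_iN.
case: i lt_iN {le_in} => [|i] lt_iN /=; first by rewrite !binn subr0.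
by rewrite ltnW // addSn binS natrD addrC addKr addnS addSn.
Qed.

Lemma hilbert_numerator (d : nat) (g H : nat -> int) :
  (forall n, H n = \sum_(j < n.+1) g j * ('C(n - j + d, d))%:R) ->
  forall n, \sum_(j < n.+1) ((1 - 'X) ^+ d.+1 : {poly int})`_j * H (n - j)%N
    = g n.
Proof.
move=> HE n; pose poly_of (a : nat -> int) := \poly_(i < n.+1) a i.
pose B := poly_of (fun i => ('C(i + d, d))%:R).
transitivity (((1 - 'X) ^+ d.+1 * poly_of H)`_n).
  rewrite coefM; apply: eq_bigr => j _.
  by rewrite [(poly_of H)`__]coef_poly ltnS leq_subr.
transitivity (((1 - 'X) ^+ d.+1 * (poly_of g * B))`_n).
  apply: eq_coefM => i le_in; rewrite coef_poly ltnS le_in HE coefM.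
  apply: eq_bigr => j _; rewrite !coef_poly !ltnS.
  by rewrite !(leq_trans _ le_in) ?leq_subr // -ltnS.
rewrite mulrCA (@eq_coefM _ _ _ 1) ?mulr1 ?coef_poly ?ltnSn // => i le_in.
by rewrite coef1; apply: coef_1subX_bin.
Qed.

Section Span.

Context (K : fieldType) (V : lmodType K) (T : eqType).
Implicit Types (s : seq T) (b : T -> V).

Definition in_span s b f := exists a : T -> K, f = \sum_(x <- s) a x *: b x.

Lemma in_span0 s b : in_span s b 0.
Proof. by exists (fun _ => 0); rewrite big1 // => x _; rewrite scale0r. Qed.

Lemma in_spanD s b f g : in_span s b f -> in_span s b g -> in_span s b (f + g).
Proof.
move=> [a ->] [c ->]; exists (fun x => a x + c x); rewrite -big_split.
by apply: eq_bigr => x _; rewrite scalerDl.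
Qed.

Lemma in_spanZ s b k f : in_span s b f -> in_span s b (k *: f).
Proof.
move=> [a ->]; exists (fun x => k * a x); rewrite scaler_sumr.
by apply: eq_bigr => x _; rewrite scalerA.
Qed.

Lemma in_span_sum s b (I : eqType) (r : seq I) (F : I -> V) :
  (forall i, i \in r -> in_span s b (F i)) -> in_span s b (\sum_(i <- r) F i).
Proof.
move=> sF; rewrite big_seq; elim/big_rec: _ => [|i x /sF]; first exact: in_span0.
exact: in_spanD.
Qed.

Lemma in_span_mem s b x : uniq s -> x \in s -> in_span s b (b x).
Proof.
move=> us xs; exists (fun y => (y == x)%:R); rewrite (bigD1_seq x) //= eqxx.
by rewrite scale1r big1 ?addr0 // => y /negbTE->; rewrite scale0r.
Qed.

End Span.

Lemma bin_addl_leq (e x k : nat) :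
  ('C(x + k, e.+1) <= 'C(x, e.+1) + k * 'C(x + k, e))%N.
Proof.
elim: k => [|k IH]; first by rewrite addn0 mul0n addn0.
rewrite addnS binS mulSn; have mono : ('C(x + k, e) <= 'C((x + k).+1, e))%N.
  by rewrite leq_bin2l.
have := leq_mul (leqnn k) mono; lia.
Qed.

(** By [bin_addl_leq] the shift by [k0] costs only terms of degree below [d] in [n], whereas the
    left side keeps the extra term [g s * 'C(n - s + d, d)] of full degree [d]. For [d = 0]
    constants are compared. *)
Lemma hilbert_growth (d m s k0 : nat) (g : nat -> nat) :
  (m <= s)%N -> (0 < g s)%N ->
  ~ (forall n, \sum_(j < n.+1) g j * 'C(n - j + d, d) <=
               \sum_(j < m) g j * 'C(n + k0 - j + d, d))%N.
Proof.
move=> le_ms gs; have split_sum k (F : nat -> nat) :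
    (\sum_(j < m) F j + F s <= \sum_(j < (s + k).+1) F j)%N.
  rewrite -[\sum_(j < m) _](big_mkord xpredT F) -[\sum_(j < _.+1) _](big_mkord xpredT F).
  have le_m : (m <= (s + k).+1)%N by lia.
  rewrite (big_cat_nat (leq0n m) le_m) /=.
  by rewrite leq_add2l (bigD1_seq s) ?iota_uniq ?leq_addr //= mem_index_iota; lia.
case: d => [|e] H.
  have := leq_trans (split_sum 0%N (fun j => g j * 'C(s + 0 - j + 0, 0)%N)%N) (H (s + 0)%N).
  under eq_bigr => j _ do rewrite bin0.
  under [in X in (_ <= X)%N]eq_bigr => j _ do rewrite bin0.
  by rewrite bin0 muln1; lia.
pose A := ((\sum_(j < m) g j) * k0)%N.
apply: (@bin_not_bounded e A (s + k0 + 2)) => k.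
have := leq_trans (split_sum k (fun j => g j * 'C(s + k - j + e.+1, e.+1)%N)%N) (H (s + k)%N).
have -> : (s + k - s = k)%N by lia.
set S1 := (\sum_(j < m) _)%N; set S2 := (\sum_(j < m) _)%N => le12.
have le_S : (S2 <= S1 + A * ((s + k0 + 2) * k.+1) ^ e)%N.
  rewrite /A -mulnA big_distrl /= -big_split /=; apply: leq_sum => j _.
  rewrite -mulnDr leq_mul2l; apply/orP; right.
  have -> : (s + k + k0 - j + e.+1 = s + k - j + e.+1 + k0)%N.
    by have := ltn_ord j; lia.
  apply: leq_trans (bin_addl_leq _ _ _) _; rewrite leq_add2l leq_mul2l.
  apply/orP; right; apply: (@leq_trans 'C(s + k + 1 + k0 + e, e)).
    by apply: leq_bin2l; lia.
  apply: leq_trans (leq_bin_exp _ _) _.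
  by apply: leq_wexp2r; nia.
apply: leq_trans (_ : g s * 'C(k + e.+1, e.+1) <= _)%N; first exact: leq_pmull.
by lia.
Qed.

(** * Multivariate polynomials *)

Definition monomials (N n : nat) : seq 'X_{1..N} :=
  [seq [multinom nat_of_ord (tnth t i) | i < N] |
    t : N.-tuple 'I_n.+1 <- enum [set t : N.-tuple 'I_n.+1 | (\sum_(i <- t) i)%N == n]].

Lemma mem_monomials (N n : nat) (m : 'X_{1..N}) :
  (m \in monomials N n) = (mdeg m == n).
Proof.
apply/mapP/eqP => [[t]|Em].
  rewrite mem_enum inE => /eqP Et ->; rewrite mdegE.
  under eq_bigr => i _ do rewrite mnmE.
  by rewrite -[RHS]Et big_tuple.
have le_m i : (m i < n.+1)%N by rewrite ltnS -Em mdegE (bigD1 i) //= leq_addr.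
exists [tuple Ordinal (le_m i) | i < N].
  rewrite mem_enum inE big_tuple; apply/eqP; rewrite -[RHS]Em mdegE.
  by apply: eq_bigr => i _; rewrite tnth_mktuple.
by apply/mnmP => i; rewrite mnmE tnth_mktuple.
Qed.

Lemma monomials_uniq (N n : nat) : uniq (monomials N n).
Proof.
rewrite map_inj_uniq ?enum_uniq // => t u /mnmP Etu.
by apply: eq_from_tnth => i; apply: val_inj; have := Etu i; rewrite !mnmE.
Qed.

Lemma size_monomials (d n : nat) : size (monomials d.+1 n) = 'C(n + d, d).
Proof. by rewrite size_map -cardE card_ord_partitions addnC. Qed.

Lemma mcoeffMXE (D : nat) (K : nzRingType) (p : {mpoly K[D]}) (m k : 'X_{1..D}) :
  (p * 'X_[m])@_k = if (m <= k)%MM then p@_(k - m) else 0.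
Proof.
case: ifP => [le_mk|/negP nle_mk].
  by rewrite -{1}(submK le_mk) addmC mcoeffMX.
apply: memN_msupp_eq0; rewrite (perm_mem (msuppMX _ _)).
by apply/mapP => -[m' _ Ek]; apply: nle_mk; rewrite Ek lem_addr.
Qed.

Lemma radix_inj (B N : nat) (f g : 'I_N -> nat) :
  (forall i, f i < B)%N -> (forall i, g i < B)%N ->
  (\sum_(i < N) f i * B ^ i = \sum_(i < N) g i * B ^ i)%N -> f =1 g.
Proof.
elim: N f g => [|N IH] f g ltf ltg; first by move=> _ [].
have E (h : 'I_N.+1 -> nat) : (\sum_(i < N.+1) h i * B ^ i =
    (\sum_(i < N) h (lift ord0 i) * B ^ i) * B + h ord0)%N.
  rewrite big_ord_recl expn0 muln1 addnC big_distrl /=; congr (_ + _)%N.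
  by apply: eq_bigr => i _; rewrite -mulnA -expnSr.
rewrite !E => Efg; have B0 : (0 < B)%N by apply: leq_ltn_trans (ltf ord0).
have E0 : f ord0 = g ord0.
  by have := congr1 (modn^~ B) Efg; rewrite /= !modnMDl !modn_small.
move: Efg; rewrite E0 => /addIn/eqP; rewrite eqn_pmul2r // => /eqP Efg i.
case: (unliftP ord0 i) => [j|] -> //.
exact: (IH (fun i => f (lift ord0 i)) (fun i => g (lift ord0 i))).
Qed.

(* Kronecker substitution [X_i := s ^ (B ^ i)] with [s] a root of [P * X - 1],
   where [P] is the resulting nonzero univariate polynomial. *)
Lemma meval_neq0_exists (K : closedFieldType) (N : nat) (g : {mpoly K[N]}) :
  g != 0 -> exists a : 'I_N -> K, (forall i, a i != 0) /\ meval a g != 0.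
Proof.
move=> g0; pose B := msize g.
have ltB m : m \in msupp g -> forall i, (m i < B)%N.
  move=> /msize_mdeg_lt lt_m i; apply: leq_ltn_trans lt_m.
  by rewrite mdegE (bigD1 i) //= leq_addr.
pose kr (m : 'X_{1..N}) := (\sum_(i < N) m i * B ^ i)%N.
pose P : {poly K} := \sum_(m <- msupp g) g@_m *: 'X^(kr m).
have P0 : P != 0.
  have m0 := mlead_supp g0; apply/eqP => /polyP/(_ (kr (mlead g))).
  rewrite coef0 coef_sum (bigD1_seq _ m0) ?msupp_uniq //= big_seq_cond.
  rewrite big1 => [|m /andP[mg /eqP ne]].
    rewrite addr0 coefZ coefXn eqxx mulr1 => /eqP.
    by rewrite mcoeff_eq0 m0.
  rewrite coefZ coefXn; case: eqP => [Em|_]; last by rewrite mulr0.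
  case: ne; apply/mnmP => i; apply/esym.
  by apply: (radix_inj (ltB _ m0) (ltB _ mg)).
have /closed_rootP[s] : size (P * 'X - 1) != 1%N.
  rewrite size_polyDl ?size_mulX // ?size_opp ?size_polyC ?oner_neq0.
    by rewrite eqSS size_poly_eq0.
  by rewrite ltnS lt0n size_poly_eq0.
rewrite rootE !hornerE subr_eq0 => /eqP Es.
have s0 : s != 0.
  by apply: contra_eq_neq Es => ->; rewrite mulr0 eq_sym oner_neq0.
have Ps0 : P.[s] != 0.
  by apply: contra_eq_neq Es => ->; rewrite mul0r eq_sym oner_neq0.
exists (fun i : 'I_N => s ^+ (B ^ i)); split=> [i|]; first by rewrite expf_neq0.
suff -> : meval (fun i : 'I_N => s ^+ (B ^ i)) g = P.[s] by [].
rewrite mevalE horner_sum; apply: eq_bigr => m _.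
rewrite hornerZ hornerXn; congr (_ * _); rewrite /kr.
elim/big_rec2: _ => [|i x y _ ->]; first by rewrite expr0.
by rewrite exprD -exprM mulnC.
Qed.

Lemma exprDn_sum (R : comNzRingType) (n : nat) (I : Type) (r : seq I)
    (P : pred I) (F : I -> R) :
  [pchar R]%R.-nat n ->
  (\sum_(i <- r | P i) F i) ^+ n = \sum_(i <- r | P i) F i ^+ n.
Proof.
move=> pn; elim/big_rec2: _ => [|i x y _ <-].
  by case: n pn => [|n]; rewrite ?expr0n.
by rewrite exprDn_pchar.
Qed.

Lemma exprn_pchar_inj (K : fieldType) (n : nat) :
  [pchar K]%R.-nat n -> injective (fun x : K => x ^+ n).
Proof.
move=> pn x y /= E; apply/eqP; rewrite -subr_eq0.
have : (x - y) ^+ n == 0 by rewrite exprDn_pchar // exprNn_pchar // E subrr.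
by rewrite expf_eq0 => /andP[].
Qed.

Lemma closed_root_exists (K : closedFieldType) (n : nat) (a : K) :
  (0 < n)%N -> exists b : K, b ^+ n = a.
Proof.
move=> n0; have /closed_rootP[b] : size ('X^n - a%:P) != 1%N.
  by rewrite size_XnsubC // eqSS -lt0n.
by rewrite rootE !hornerE subr_eq0 => /eqP; exists b.
Qed.

(** At [z] the polynomial [pi f] has the q-th root of the coefficient of [f] at [w + z *+ q] divided
    by that of [c] at [w]. The exponents of [c] are below [q], so [c] contributes only at [z = 0],
    whence [pi c = 1]. *)
Lemma frobenius_splitting (K : closedFieldType) (D q : nat) (c : {mpoly K[D]})
    (w : 'X_{1..D}) :
  (0 < q)%N -> [pchar K]%R.-nat q -> w \in msupp c ->
  (forall m, m \in msupp c -> forall i, (m i < q)%N) ->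
  exists pi : {mpoly K[D]} -> {mpoly K[D]},
  [/\ forall f z, (pi f)@_z != 0 -> f@_(w + z *+ q) != 0,
      forall (I : Type) (r : seq I) (F : I -> {mpoly K[D]}),
        pi (\sum_(i <- r) F i) = \sum_(i <- r) pi (F i),
      forall h f, pi (h ^+ q * f) = h * pi f &
      pi c = 1].
Proof.
move=> q0 pq wc ltq; have cw0 : c@_w != 0 by rewrite -mcoeff_msupp.
have pqS : [pchar {mpoly K[D]}]%R.-nat q.
  by apply: sub_in_pnat pq => r _; rewrite pchar_lalg.
have /choice[rt rtE] (a : K) := closed_root_exists a q0.
(* Bounding the degree of [z] by [msize f] loses nothing: beyond it [w + z *+ q] is outside the
   support of [f], as [q > 0]. *)
pose pi f : {mpoly K[D]} :=
  \sum_(z : 'X_{1..D < msize f}) rt (f@_(w + z *+ q) / c@_w) *: 'X_[z].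
have piE f z : ((pi f)@_z) ^+ q = f@_(w + z *+ q) / c@_w.
  case: (ltnP (mdeg z) (msize f)) => lt_z.
    by rewrite (mcoeff_mpoly (fun z => rt (f@_(w + z *+ q) / c@_w))) ?rtE.
  have -> : f@_(w + z *+ q) = 0.
    apply/memN_msupp_eq0/msize_mdeg_ge; rewrite mdegD mdegMn; nia.
  rewrite raddf_sum big1 ?expr0n ?mul0r ?gtn_eqF //= => y _.
  rewrite mcoeffZ mcoeffX (_ : bmnm y == z = false) ?mulr0 //.
  by apply: contraTF lt_z => /eqP <-; rewrite -ltnNge bmdeg.
have piP f g : (forall z, (g@_z) ^+ q = f@_(w + z *+ q) / c@_w) -> pi f = g.
  move=> E; apply/mpolyP => z; apply: (exprn_pchar_inj pq).
  by rewrite /= piE E.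
have pi0 : pi 0 = 0.
  by apply: piP => z; rewrite !mcoeff0 mul0r expr0n gtn_eqF.
have piD f g : pi (f + g) = pi f + pi g.
  by apply: piP => z; rewrite !mcoeffD exprDn_pchar // !piE mulrDl.
have pi_sum (I : Type) (r : seq I) (F : I -> {mpoly K[D]}) :
    pi (\sum_(i <- r) F i) = \sum_(i <- r) pi (F i).
  exact: (big_morph pi piD pi0).
have piX a v f : pi ((a *: 'X_[v]) ^+ q * f) = (a *: 'X_[v]) * pi f.
  apply: piP => z; rewrite exprZn mpolyXn -!scalerAl !mcoeffZ exprMn -mulrA.
  congr (_ * _); rewrite ['X_[v] * _]mulrC ['X_[_] * f]mulrC !mcoeffMXE.
  have -> : ((v *+ q <= w + z *+ q) = (v <= z))%MM.
    apply/mnm_lepP/mnm_lepP => le i; move: (le i);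
      rewrite !(mulmnE, mnmDE); have := ltq _ wc i; nia.
  case: ifP => [/mnm_lepP le|_]; last by rewrite expr0n gtn_eqF // mul0r.
  rewrite piE; congr (_@_ _ / _); apply/mnmP => i.
  by rewrite !(mnmDE, mnmBE, mulmnE); have := le i; nia.
exists pi; split=> // [f z|h f|].
- apply: contraNneq => f0; have /eqP := piE f z.
  by rewrite f0 mul0r expf_eq0 => /andP[].
- rewrite {1 2}[h]mpolyE exprDn_sum // !mulr_suml pi_sum.
  by apply: eq_bigr => v _; apply: piX.
apply: piP => z; rewrite mcoeff1; case: (eqVneq z 0%MM) => [->|z0].
  have -> : (0 *+ q = 0 :> 'X_{1..D})%MM.
    by apply/mnmP => i; rewrite mulmnE mnm0E mul0n.
  by rewrite expr1n addm0 divff.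
rewrite expr0n gtn_eqF // memN_msupp_eq0 ?mul0r //.
apply: contra z0 => /ltq lt_z; apply/eqP/mnmP => i; rewrite mnm0E.
by have := lt_z i; rewrite mnmDE mulmnE; nia.
Qed.

Lemma mpoly_in_powers (K : comNzRingType) (N q : nat) (t : {mpoly K[N]}) :
  (forall r : 'X_{1..N}, (forall i, r i < q)%N -> t@_r = 0) ->
  exists s : 'I_N -> {mpoly K[N]}, t = \sum_(i < N) 'X_i ^+ q * s i.
Proof.
move=> t0; rewrite [t]mpolyE big_seq.
elim/big_rec: _ => [|m x mt [s ->]].
  by exists (fun _ => 0); rewrite big1 // => i _; rewrite mulr0.
have [i le_i] : exists i, (q <= m i)%N.
  apply: contrapT => no_i; move: mt; rewrite mcoeff_msupp t0 ?eqxx // => i.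
  by rewrite ltnNge; apply/negP => le_i; apply: no_i; exists i.
exists (fun j => s j + (j == i)%:R * (t@_m *: 'X_[m - U_(i) *+ q])).
under [RHS]eq_bigr => j _ do rewrite mulrDr.
rewrite big_split addrC; congr (_ + _) => /=.
rewrite (bigD1 i) //= eqxx mul1r big1 => [|j /negbTE->].
  rewrite addr0 -scalerAr mpolyXn -mpolyXD; congr (_ *: 'X_[_]).
  apply/mnmP => j; rewrite !(mnmDE, mnmBE, mulmnE, mnm1E).
  by case: eqP => [<-|_]; lia.
by rewrite mul0r mulr0.
Qed.

(** * Algebras of normal affine monoids *)

Section MonoidAlgebra.

Context (K : closedFieldType) (D : nat).
Context (dg : 'X_{1..D} -> nat) (C : pred 'X_{1..D}).
Hypothesis dgD : forall m m', dg (m + m')%MM = (dg m + dg m')%N.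
Hypothesis C0 : C 0%MM.
Hypothesis CD : forall m m', C m -> C m' -> C (m + m')%MM.

Local Notation S := {mpoly K[D]}.
Implicit Types (P Q T : pred 'X_{1..D}) (f g : S) (m : 'X_{1..D}).

(** Subspaces of the polynomial ring cut out by conditions on exponents; [supp C] is the monoid
    algebra itself. *)
Definition supp P f := {subset msupp f <= P}.
Definition hpart (n : nat) := supp [pred m | C m && (dg m == n)].
(* [hpartp n.+1] is [hpart n], and [hpartp 0] is zero. *)
Definition hpartp (n : nat) := supp [pred m | C m && ((dg m).+1 == n)].
(** For [th i] of degree one, the degree [n] piece of the ideal they generate in the monoid algebra:
    the cofactors, too, must be supported in [C]. *)
Definition lideal N (th : 'I_N -> S) n f :=
  exists r : 'I_N -> S, (forall i, hpartp n (r i)) /\ f = \sum_(i < N) th i * r i.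
(** Graded form of module-finiteness over K[theta]: the quotient by the ideal vanishes from degree
    [n1] on. *)
Definition finite_over N (th : 'I_N -> S) n1 :=
  forall n, (n1 <= n)%N -> forall f, hpart n f -> lideal th n f.

Arguments hpart n%_nat_scope f.
Arguments hpartp n%_nat_scope f.
Arguments lideal {N}%_nat_scope th n%_nat_scope f.
Arguments finite_over {N}%_nat_scope th n1%_nat_scope.

Lemma dg0 : dg 0%MM = 0%N.
Proof.
by have /eqP := dgD 0%MM 0%MM; rewrite addm0 -{1}[dg _]addn0 eqn_add2l => /eqP.
Qed.

Lemma supp_sub P Q f : {subset P <= Q} -> supp P f -> supp Q f.
Proof. by move=> PQ Pf m /Pf /PQ. Qed.

Lemma supp0 P : supp P 0.
Proof. by move=> m; rewrite msupp0. Qed.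

Lemma suppD P f g : supp P f -> supp P g -> supp P (f + g).
Proof. by move=> Pf Pg m /msuppD_le; rewrite mem_cat => /orP[/Pf|/Pg]. Qed.

Lemma suppZ P (a : K) f : supp P f -> supp P (a *: f).
Proof. by move=> Pf m /msuppZ_le /Pf. Qed.

Lemma supp_sum P (I : Type) (r : seq I) (Q' : pred I) (F : I -> S) :
  (forall i, Q' i -> supp P (F i)) -> supp P (\sum_(i <- r | Q' i) F i).
Proof. by move=> PF; elim/big_rec: _ => [|i x /PF]; [apply: supp0 | apply: suppD]. Qed.

Lemma suppX P m : P m -> supp P 'X_[m].
Proof. by move=> Pm m'; rewrite msuppX inE => /eqP->. Qed.

Lemma suppM P Q T f g : (forall m m', P m -> Q m' -> T (m + m')%MM) ->
  supp P f -> supp Q g -> supp T (f * g).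
Proof.
move=> PQT Pf Qg m /msuppM_le /allpairsP[[m1 m2] /= [/Pf P1 /Qg Q2 ->]].
exact: PQT.
Qed.

Lemma supp_mcoeff P f m : supp P f -> ~~ P m -> f@_m = 0.
Proof. by move=> Pf nPm; apply/memN_msupp_eq0; apply: contra nPm => /Pf. Qed.

Lemma hpartM a b f g : hpart a f -> hpart b g -> hpart (a + b)%N (f * g).
Proof.
apply: suppM => m m' /= /andP[Cm /eqP<-] /andP[Cm' /eqP<-].
by rewrite CD // dgD eqxx.
Qed.

Lemma hpartMp a b f g : hpart a f -> hpartp b g -> hpartp (a + b)%N (f * g).
Proof.
apply: suppM => m m' /= /andP[Cm /eqP<-] /andP[Cm' /eqP<-].
by rewrite CD // dgD addnS eqxx.
Qed.

Lemma hpart1Mp n f g : hpart 1 f -> hpartp n g -> hpart n (f * g).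
Proof.
apply: suppM => m m' /= /andP[Cm /eqP E] /andP[Cm' /eqP<-].
by rewrite CD // dgD E add1n eqxx.
Qed.

Lemma hpartX m : C m -> hpart (dg m) 'X_[m].
Proof. by move=> Cm; apply: suppX => /=; rewrite Cm eqxx. Qed.

Lemma hpart1 : hpart 0 1.
Proof. by rewrite -mpolyX0 -{1}dg0; apply: hpartX. Qed.

Lemma hpartXn a f n : hpart a f -> hpart (a * n)%N (f ^+ n).
Proof.
move=> Ra; elim: n => [|n IH]; first by rewrite muln0 expr0; apply: hpart1.
by rewrite mulnS exprS; apply: hpartM.
Qed.

Lemma hpartp_predn n f : hpartp n f -> hpart n.-1 f.
Proof. by apply: supp_sub => m /andP[Cm /eqP<-]; rewrite inE Cm /=. Qed.

Lemma hpartpS n f : hpart n f -> hpartp n.+1 f.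
Proof. by apply: supp_sub => m /andP[Cm /eqP<-]; rewrite inE Cm /=. Qed.

Lemma lideal0 N (th : 'I_N -> S) n : lideal th n 0.
Proof.
exists (fun _ => 0); split=> [i|]; first exact: supp0.
by rewrite big1 // => i _; rewrite mulr0.
Qed.

Lemma lidealD N (th : 'I_N -> S) n f g : lideal th n f -> lideal th n g -> lideal th n (f + g).
Proof.
move=> [r [Rr ->]] [s [Rs ->]]; exists (fun i => r i + s i); split=> [i|].
  exact: suppD (Rr i) (Rs i).
by rewrite -big_split; apply: eq_bigr => i _; rewrite mulrDr.
Qed.

Lemma lidealZ N (th : 'I_N -> S) n a f : lideal th n f -> lideal th n (a *: f).
Proof.
move=> [r [Rr ->]]; exists (fun i => a *: r i); split=> [i|]; first exact: suppZ (Rr i).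
by rewrite scaler_sumr; apply: eq_bigr => i _; rewrite scalerAr.
Qed.

Lemma lidealN N (th : 'I_N -> S) n f : lideal th n f -> lideal th n (- f).
Proof. by rewrite -scaleN1r; apply: lidealZ. Qed.

Lemma lideal_sum N (th : 'I_N -> S) n (I : Type) (r : seq I) (F : I -> S) :
  (forall i, lideal th n (F i)) -> lideal th n (\sum_(i <- r) F i).
Proof. by move=> JF; elim/big_rec: _ => [|i x _]; [apply: lideal0 | apply: lidealD]. Qed.

Lemma lidealM N (th : 'I_N -> S) a b f g :
  hpart a f -> lideal th b g -> lideal th (a + b)%N (f * g).
Proof.
move=> Rf [r [Rr ->]]; exists (fun i => f * r i); split=> [i|]; first exact: hpartMp.
by rewrite mulr_sumr; apply: eq_bigr => i _; rewrite mulrCA.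
Qed.

Lemma lideal1 N (th : 'I_N -> S) i : lideal th 1 (th i).
Proof.
exists (fun j => (j == i)%:R); split=> [j|].
  by apply: hpartpS; case: eqP => _; [apply: hpart1 | apply: supp0].
by rewrite (bigD1 i) //= eqxx mulr1 big1 ?addr0 // => j /negbTE->; rewrite mulr0.
Qed.

(** * Noether normalization with parameters of degree one *)

Local Notation ev th := (mmap (@mpolyC D K) th).

(* Modulo the [th' i] every [th i] is a multiple of the last one, [t]; the
   relation [g] then makes a power of [t] vanish. *)
Lemma noether_step N (th : 'I_N.+1 -> S) n1 (g : {mpoly K[N.+1]}) e :
  (forall i, hpart 1 (th i)) -> finite_over th n1 ->
  g != 0 -> g \is e.-homog -> ev th g = 0 ->
  exists (th' : 'I_N -> S) (n1' : nat),
    (forall i, hpart 1 (th' i)) /\ finite_over th' n1'.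
Proof.
move=> Rth fin_th g0 g_hom ev0; have [a [a0 ga0]] := meval_neq0_exists g0.
pose t := th ord_max; pose b i := a i / a ord_max.
pose th' (i : 'I_N) := th (lift ord_max i) - b (lift ord_max i) *: t.
have Rth' i : hpart 1 (th' i).
  by apply: suppD; [|rewrite -scaleNr; apply: suppZ]; apply: Rth.
have thJ i : lideal th' 1 (th i - b i *: t).
  case: (unliftP ord_max i) => [j|] ->; first exact: lideal1.
  by rewrite /b divff // scale1r subrr; apply: lideal0.
have RtX (l : nat) : hpart l (t ^+ l) by rewrite -[l in hpart l]mul1n; apply/hpartXn/Rth.
(* [cong n f c] says that [f] is [c *: t ^+ n] modulo the [th']. Such congruences multiply, so
   [ev th g = 0] puts [meval b g *: t ^+ e] into the ideal, and by homogeneity [meval b g] is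
   nonzero because [meval a g] is. *)
pose cong (n : nat) f c := hpart n f /\ lideal th' n (f - c *: t ^+ n).
have congM (n n' : nat) f f' c c' :
    cong n f c -> cong n' f' c' -> cong (n + n')%N (f * f') (c * c').
  move=> [Rf Jf] [Rf' Jf']; split; first exact: hpartM.
  have -> : f * f' - (c * c') *: t ^+ (n + n') =
      f' * (f - c *: t ^+ n) + (c *: t ^+ n) * (f' - c' *: t ^+ n').
    by rewrite -!mul_mpolyC rmorphM exprD; ring.
  apply: lidealD; first by rewrite addnC; apply: lidealM.
  by apply: lidealM => //; exact: suppZ (RtX n).
have cong1 i : cong 1%N (th i) (b i) by rewrite /cong expr1.
have congX i (n : nat) : cong n (th i ^+ n) (b i ^+ n).
  elim: n => [|n IH]; last by rewrite !exprS -add1n; apply: congM.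
  by rewrite /cong !expr0 scale1r subrr; split; [apply: hpart1 | apply: lideal0].
have cong_mmap1 (m : 'X_{1..N.+1}) : cong (mdeg m) (mmap1 th m) (mmap1 b m).
  rewrite mdegE /mmap1; elim/big_rec3: _ => [|i x y z _]; last exact: congM.
  by rewrite /cong expr0 scale1r subrr; split; [apply: hpart1 | apply: lideal0].
have meval_b : meval b g * a ord_max ^+ e = meval a g.
  rewrite !mevalE mulr_suml big_seq [RHS]big_seq; apply: eq_bigr => m mg.
  have Ee : mdeg m = e := dhomog_mf g_hom mg.
  rewrite -mulrA -Ee mdegE; congr (_ * _).
  elim/big_rec3: _ => [|i x y z _ IH]; first by rewrite mul1r.
  by rewrite -IH exprD mulrACA -exprMn divfK.
have gb0 : meval b g != 0.
  by apply: contraNneq ga0 => gb; rewrite -meval_b gb mul0r.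
have Jte : lideal th' e (t ^+ e).
  have : lideal th' e (\sum_(m <- msupp g) g@_m *: (mmap1 th m - mmap1 b m *: t ^+ e)).
    rewrite big_seq; apply: big_rec => [|m x mg]; first exact: lideal0.
    have Ee : mdeg m = e := dhomog_mf g_hom mg.
    by apply/lidealD/lidealZ; have [_] := cong_mmap1 m; rewrite Ee.
  under eq_bigr => m _ do rewrite scalerBr scalerA.
  rewrite sumrB -scaler_suml (_ : \sum_(m <- _) _ *: mmap1 th m = 0); last first.
    by rewrite -[RHS]ev0 /mmap; apply: eq_bigr => m _; rewrite mul_mpolyC.
  rewrite sub0r -[\sum_(m <- _) _]mevalE => /lidealN/(lidealZ (meval b g)^-1).
  by rewrite opprK scalerA mulVf // scale1r.
exists th', (n1 + e)%N; split=> // n le_n f Rf.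
(* Each use of [fin_th] trades the factors [th i] for [b i *: t] modulo the [th'] and so extracts
   one power of [t]; from degree [n1 + e] on, [e] uses are possible. *)
have step l : (n1 + l <= n)%N ->
    exists r, hpart (n - l)%N r /\ lideal th' n (f - t ^+ l * r).
  elim: l => [|l IH] le_l.
    by exists f; rewrite subn0 expr0 mul1r subrr; split=> //; apply: lideal0.
  have [|r [Rr Jr]] := IH; first lia.
  have [|s [Rs Es]] := fin_th (n - l)%N _ r Rr; first lia.
  exists (\sum_i b i *: s i); split.
    apply: supp_sum => i _; apply: suppZ.
    by rewrite subnS; apply: hpartp_predn; apply: Rs.
  have -> : f - t ^+ l.+1 * \sum_i b i *: s i =
      f - t ^+ l * r + t ^+ l * \sum_i (s i * (th i - b i *: t)).
    rewrite Es exprSr -mulrA.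
    have -> : \sum_i s i * (th i - b i *: t) =
        \sum_i th i * s i - t * \sum_i b i *: s i.
      rewrite mulr_sumr -sumrB; apply: eq_bigr => i _.
      by rewrite mulrBr [s i * th i]mulrC -!scalerAr [s i * t]mulrC.
    by rewrite mulrBr addrA addrNK.
  apply: lidealD => //; have -> : n = (l + (n - l))%N by lia.
  apply: lidealM => //; apply: lideal_sum => i; have -> : (n - l = (n - l).-1 + 1)%N by lia.
  by apply: lidealM; [apply: hpartp_predn; apply: Rs | apply: thJ].
have [|r [Rr Jr]] := step e; first lia.
rewrite -(subrK (t ^+ e * r) f); apply: lidealD => //; rewrite mulrC.
by have -> : n = (n - e + e)%N by [lia]; apply: lidealM.
Qed.

Context (d : nat) (Cs : nat -> seq 'X_{1..D}).
Hypothesis Cs_uniq : forall n, uniq (Cs n).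
Hypothesis mem_Cs : forall n m, (m \in Cs n) = C m && (dg m == n).
Context (n0 A M0 M1 : nat).
Hypothesis C_split : forall m, C m -> (n0 <= dg m)%N -> exists v m',
  [/\ C v, dg v = 1%N, C m' & m = (v + m')%MM].
Hypothesis Cs_upper : forall n, (size (Cs n) <= A * (M0 * n.+1) ^ d)%N.
Hypothesis M1_gt0 : (0 < M1)%N.
Hypothesis Cs_lower : forall k, ('C(k + d, d) <= size (Cs (k * M1)))%N.

Lemma hpart_expand n f : hpart n f -> f = \sum_(m <- Cs n) f@_m *: 'X_[m].
Proof.
move=> Rf; apply/mpolyP => m; rewrite raddf_sum /=.
under eq_bigr => m' _ do rewrite mcoeffZ mcoeffX.
case: (boolP (m \in Cs n)) => mC.
  rewrite (bigD1_seq m) //= eqxx mulr1 big1 ?addr0 // => m' /negbTE ne.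
  by rewrite ne mulr0.
rewrite (supp_mcoeff Rf) ?big_seq ?big1 //= => [m' m'C|].
  by rewrite (_ : m' == m = false) ?mulr0 //; apply: contraNF mC => /eqP <-.
by rewrite -mem_Cs.
Qed.

Lemma Cs_indep n (a : 'X_{1..D} -> K) :
  \sum_(m <- Cs n) a m *: 'X_[m] = 0 :> S -> forall m, m \in Cs n -> a m = 0.
Proof.
move=> E m mC; have := congr1 (mcoeff m) E; rewrite raddf_sum /= mcoeff0.
under eq_bigr => m' _ do rewrite mcoeffZ mcoeffX.
by rewrite (bigD1_seq m) //= eqxx mulr1 big1 ?addr0 // => m' /negbTE->; rewrite mulr0.
Qed.

(** Index set for the degree [n] part of the K[theta]-module generated by the monomials of [es];
    [gens] gives the corresponding products. *)
Definition pairs N (es : seq 'X_{1..D}) n : seq ('X_{1..N} * 'X_{1..D}) :=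
  [seq (al, m) | m <- [seq m <- es | (dg m <= n)%N], al <- monomials N (n - dg m)].

Lemma mem_pairs N es n x :
  (x \in pairs N es n) = (x.2 \in es) && (mdeg x.1 + dg x.2 == n)%N.
Proof.
apply/allpairsPdep/andP => [[m [al []]]|[xes /eqP Ex]].
  rewrite mem_filter => /andP[le_m mes]; rewrite mem_monomials => /eqP Eal ->.
  by rewrite /= mes Eal subnK.
exists x.2, x.1; rewrite mem_filter xes mem_monomials -{2}Ex addnK eqxx -Ex leq_addl.
by split=> //; case: x {xes Ex}.
Qed.

Lemma pairs_uniq N es n : uniq es -> uniq (pairs N es n).
Proof.
move=> ues; apply: allpairs_uniq_dep; first exact: filter_uniq.
  by move=> m _; apply: monomials_uniq.
by move=> [m al] [m' al'] _ _ /= [-> ->].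
Qed.

Definition gens N (th : 'I_N -> S) (x : 'X_{1..N} * 'X_{1..D}) : S :=
  mmap1 th x.1 * 'X_[x.2].

Lemma in_span_th N (th : 'I_N -> S) es n f i : uniq es ->
  in_span (pairs N es n) (gens th) f ->
  in_span (pairs N es n.+1) (gens th) (th i * f).
Proof.
move=> ues [a ->]; rewrite mulr_sumr; apply: in_span_sum => x.
rewrite mem_pairs => /andP[xes /eqP Ex]; rewrite -scalerAr; apply: in_spanZ.
have -> : th i * gens th x = gens th ((U_(i) + x.1)%MM, x.2).
  by rewrite /gens /= commr_mmap1_M ?mmap1U ?mulrA // => *; apply: mulrC.
by apply: in_span_mem; rewrite ?pairs_uniq // mem_pairs xes mdegD mdeg1 -Ex add1n addSn /=.
Qed.

Lemma hpartp0 f : hpartp 0 f -> f = 0.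
Proof.
move=> Rf; apply/mpolyP => m; rewrite mcoeff0 (supp_mcoeff Rf) //=.
by rewrite andbF.
Qed.

Lemma in_span_lideal N (th : 'I_N -> S) es n f : uniq es ->
  (forall g, hpartp n g -> in_span (pairs N es n.-1) (gens th) g) ->
  lideal th n f -> in_span (pairs N es n) (gens th) f.
Proof.
move=> ues; case: n => [|n] sp [r [Rr ->]]; apply: in_span_sum => i _.
  by rewrite (hpartp0 (Rr i)) mulr0; apply: in_span0.
by apply: in_span_th => //; apply: sp.
Qed.

Definition low n := flatten [seq Cs j | j <- iota 0 n.+1].

Lemma mem_low n m : (m \in low n) = C m && (dg m <= n)%N.
Proof.
apply/flatten_mapP/andP => [[j]|[Cm le_m]].
  by rewrite mem_iota /= mem_Cs => lt_j /andP[-> /eqP->].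
by exists (dg m); rewrite ?mem_Cs ?Cm ?eqxx // mem_iota.
Qed.

Lemma low_uniq n : uniq (undup (low n)).
Proof. exact: undup_uniq. Qed.

(** Graded Nakayama: from degree [n1] on the cofactors have smaller degree and induction applies;
    below, the monomials are themselves among the generators. *)
Lemma finite_over_span N (th : 'I_N -> S) n1 n f : finite_over th n1 -> hpart n f ->
  in_span (pairs N (undup (low n1)) n) (gens th) f.
Proof.
move=> fin; elim/ltn_ind: n f => n IH f Rf; case: (leqP n1 n) => [le_n|lt_n].
  apply: (in_span_lideal (low_uniq n1) _ (fin n le_n f Rf)) => g Rg.
  case: n IH Rg {f Rf le_n} => [|n] IH Rg; last exact: IH (hpartp_predn Rg).
  by rewrite (hpartp0 Rg); apply: in_span0.
rewrite (hpart_expand Rf); apply: in_span_sum => m; rewrite mem_Cs => /andP[Cm /eqP Em].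
apply: in_spanZ; have -> : 'X_[m] = gens th (0%MM, m) by rewrite /gens mmap11 mul1r.
apply: in_span_mem; rewrite ?pairs_uniq ?low_uniq //.
by rewrite mem_pairs mem_undup mem_low Cm mdeg0 Em /= add0n eqxx andbT ltnW.
Qed.

Lemma size_pairs e es n : size (pairs e.+1 es n) =
  (\sum_(m <- es | dg m <= n) 'C(n - dg m + e, e))%N.
Proof.
rewrite size_allpairs_dep -big_filter sumnE big_map.
by apply: eq_bigr => m _; rewrite size_monomials.
Qed.

Lemma Cs_size_leq N (th : 'I_N -> S) n1 n : finite_over th n1 ->
  (size (Cs n) <= size (pairs N (undup (low n1)) n))%N.
Proof.
move=> fin; apply: (@indep_span_leq K S _ _ _ _ (fun m => 'X_[m]) (gens th)).
- exact: Cs_uniq.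
- exact: Cs_indep.
move=> m; rewrite mem_Cs => /andP[Cm /eqP <-].
exact: finite_over_span fin (hpartX Cm).
Qed.

(** With [d > 0] parameters the Hilbert function would be bounded by a polynomial of degree [d - 1],
    against [Cs_lower]; with none, the algebra would vanish above degree [n1]. *)
Lemma not_finite_over_d (th : 'I_d -> S) n1 : ~ finite_over th n1.
Proof.
case: d Cs_lower th => [|e] low_d th fin.
  have := low_d n1.+1; rewrite bin0 => /leq_trans/(_ (Cs_size_leq _ fin)).
  rewrite lt0n size_eq0 => /eqP; apply; apply/nilP; rewrite /nilp size_eq0.
  case E : (pairs _ _ _) => [|x xs] //.
  have := mem_head x xs; rewrite -E mem_pairs mem_undup mem_low mdegE big_ord0.
  by move=> /andP[/andP[_ le_x] /eqP]; nia.
apply: (@bin_not_bounded e (size (undup (low n1))) M1) => k.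
apply: leq_trans (leq_trans (low_d k) (Cs_size_leq _ fin)) _.
rewrite size_pairs -sum1_size big_distrl /= big_mkcond leq_sum // => m _.
case: ifP => // _; rewrite mul1n; apply: leq_trans (leq_bin_exp _ _) _.
by apply: leq_wexp2r; nia.
Qed.

Lemma hpart_mmap1 N (th : 'I_N -> S) (m : 'X_{1..N}) :
  (forall i, hpart 1 (th i)) -> hpart (mdeg m) (mmap1 th m).
Proof.
move=> Rth; rewrite mdegE /mmap1; elim/big_rec2: _ => [|i x y _ Rx]; first exact: hpart1.
by apply: hpartM => //; have := @hpartXn _ _ (m i) (Rth i); rewrite mul1n.
Qed.

(** The ['C(n + N, N)] monomials of degree [n] in the parameters grow with exponent [N > d], while
    [Cs_upper] bounds the dimension with exponent [d]. The dependence found lies in a single degree,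
    so the relation is homogeneous. *)
Lemma algebraic_relation N (th : 'I_N.+1 -> S) : (d < N)%N ->
  (forall i, hpart 1 (th i)) ->
  exists (g : {mpoly K[N.+1]}) e, [/\ g != 0, g \is e.-homog & ev th g = 0].
Proof.
move=> lt_dN Rth; apply: contrapT => no_rel.
apply: (@bin_not_bounded d A M0) => n.
apply: leq_trans (Cs_upper n); have le_bin : ('C(n + d.+1, d.+1) <= 'C(n + N, N))%N.
  rewrite -[X in (X <= _)%N]bin_sub ?leq_addl // -[X in (_ <= X)%N]bin_sub ?leq_addl //.
  by rewrite !addnK leq_bin2l // leq_add2l.
apply: leq_trans le_bin _; rewrite -size_monomials.
apply: (@indep_span_leq K S _ _ _ _ (mmap1 th) (fun m => 'X_[m])).
- exact: monomials_uniq.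
- move=> a a_rel m mM; apply: contrapT => /eqP am0; apply: no_rel.
  exists (\sum_(m <- monomials N.+1 n) a m *: 'X_[m]), n; split.
  + apply/eqP => /(congr1 (mcoeff m)); rewrite raddf_sum mcoeff0 /=.
    under eq_bigr => m' _ do rewrite mcoeffZ mcoeffX.
    rewrite (bigD1_seq m) ?monomials_uniq //= eqxx mulr1 big1 => [|m' /negbTE->].
      by rewrite addr0; apply/eqP.
    by rewrite mulr0.
  + rewrite big_seq; apply: rpred_sum => m'; rewrite mem_monomials => Em'.
    by apply: rpredZ; rewrite dhomogX.
  + rewrite -[RHS]a_rel raddf_sum; apply: eq_bigr => m' _.
    by rewrite /= mmapZ mmapX mul_mpolyC.
move=> m; rewrite mem_monomials => /eqP Em; exists (fun u => (mmap1 th m)@_u).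
by apply: hpart_expand; rewrite -Em; apply: hpart_mmap1.
Qed.

Lemma noether_normalization : exists (th : 'I_d.+1 -> S) n1,
  (forall i, hpart 1 (th i)) /\ finite_over th n1.
Proof.
suff desc k : (exists (th : 'I_(k + d.+1) -> S) n1,
    (forall i, hpart 1 (th i)) /\ finite_over th n1) ->
    exists (th : 'I_d.+1 -> S) n1, (forall i, hpart 1 (th i)) /\ finite_over th n1.
  apply: (desc (size (Cs 1))).
  (* Start from all monomials of degree one, padded with zeros so that their number has the form
     [k + d.+1]. *)
  pose mon i := nth 0%MM (Cs 1) i.
  pose th (i : 'I_(size (Cs 1) + d.+1)) : S :=
    if (i < size (Cs 1))%N then 'X_[mon i] else 0.
  have Rth i : hpart 1 (th i).
    rewrite /th; case: ifP => [lt_i|_]; last exact: supp0.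
    have := mem_nth 0%MM lt_i; rewrite mem_Cs => /andP[Cm /eqP Em].
    by have := hpartX Cm; rewrite Em.
  exists th, n0.+1; split=> // n lt_n f Rf; rewrite (hpart_expand Rf) big_seq.
  elim/big_rec: _ => [|m x mC]; first exact: lideal0.
  apply/lidealD/lidealZ; move: mC; rewrite mem_Cs => /andP[Cm /eqP Em].
  have [|v [m' [Cv Ev Cm' Emm]]] := C_split Cm; first by rewrite Em ltnW.
  have vC : v \in Cs 1 by rewrite mem_Cs Cv Ev.
  have lt_i : (index v (Cs 1) < size (Cs 1) + d.+1)%N.
    by apply: leq_trans (leq_addr _ _); rewrite index_mem.
  have Eth : th (Ordinal lt_i) = 'X_[v] by rewrite /th /= index_mem vC /mon nth_index.
  rewrite -Em Emm dgD Ev [(1 + _)%N]addnC mpolyXD mulrC -Eth.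
  by apply: lidealM (lideal1 _ _); apply: hpartX.
elim: k => [//|k IH] [th [n1 [Rth fin]]]; apply: IH.
have [|g [e [g0 g_hom gth]]] := @algebraic_relation (k + d.+1) th _ Rth.
  by rewrite addnS ltnS leq_addl.
exact: noether_step Rth fin g0 g_hom gth.
Qed.

(** * Freeness over the parameter algebra *)

Context (th : 'I_d.+1 -> S) (n1 : nat).
Hypothesis Rth : forall i, hpart 1 (th i).
Hypothesis fin_th : finite_over th n1.

Local Notation T := {mpoly K[d.+1]}.

Lemma ev_pihomog (g : T) e (u : 'X_{1..D}) :
  dg u = e -> (ev th g)@_u = (ev th (pihomog mdeg e g))@_u.
Proof.
move=> Eu; rewrite pihomogE (raddf_sum (ev th)) /= [RHS]raddf_sum /=.
rewrite [in LHS]/mmap [LHS]raddf_sum /= [RHS]big_mkcond /=.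
apply: eq_bigr => m _; rewrite mul_mpolyC mcoeffZ; case: eqP => [Em|ne].
  by rewrite mmapZ mmapX mul_mpolyC mcoeffZ.
rewrite (supp_mcoeff (hpart_mmap1 Rth)) ?mulr0 //= negb_and Eu.
by apply/orP; right; apply/eqP => E; apply: ne.
Qed.

(** The parameters are algebraically independent: a relation has a nonzero homogeneous component
    that is again a relation, and [noether_step] would then leave [d] parameters, contrary to
    [not_finite_over_d]. *)
Lemma ev_inj (g : T) : ev th g = 0 -> g = 0.
Proof.
move=> ev0; apply/eqP; apply: contraT => g0.
pose e := mdeg (mlead g); pose g' := pihomog mdeg e g.
have g'0 : g' != 0.
  apply/eqP => /(congr1 (mcoeff (mlead g))); rewrite mcoeff0 /g' pihomogE raddf_sum /=.
  under eq_bigr => m _ do rewrite mcoeffZ mcoeffX.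
  rewrite -big_filter (bigD1_seq (mlead g)) ?filter_uniq ?msupp_uniq //=; last first.
    by rewrite mem_filter /= eqxx mlead_supp.
  rewrite eqxx mulr1 big1 => [|m /negbTE->]; last by rewrite mulr0.
  by move/eqP; rewrite addr0 mleadc_eq0 (negbTE g0).
have ev'0 : ev th g' = 0.
  apply/mpolyP => u; rewrite mcoeff0; case: (eqVneq (dg u) e) => [Eu|ne].
    by rewrite -ev_pihomog // ev0 mcoeff0.
  rewrite /g' pihomogE (raddf_sum (ev th)) /= raddf_sum big1 //= => m /eqP Em.
  rewrite mmapZ mmapX mul_mpolyC mcoeffZ (supp_mcoeff (hpart_mmap1 Rth)) ?mulr0 //=.
  by rewrite negb_and Em ne orbT.
have [th' [n1' [_ fin']]] := noether_step Rth fin_th g'0 (pihomogP _ _ _) ev'0.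
by case: (not_finite_over_d fin').
Qed.

Definition T_free k (b : 'I_k -> S) :=
  forall f : 'I_k -> T, \sum_i ev th (f i) * b i = 0 -> forall i, f i = 0.

Definition T_span k (b : 'I_k -> S) f :=
  exists t : 'I_k -> T, f = \sum_i ev th (t i) * b i.

Lemma T_span0 k (b : 'I_k -> S) : T_span b 0.
Proof. by exists (fun _ => 0); rewrite big1 // => i _; rewrite raddf0 mul0r. Qed.

Lemma T_spanD k (b : 'I_k -> S) f g : T_span b f -> T_span b g -> T_span b (f + g).
Proof.
move=> [t ->] [u ->]; exists (fun i => t i + u i); rewrite -big_split.
by apply: eq_bigr => i _; rewrite raddfD mulrDl.
Qed.

Lemma T_spanM k (b : 'I_k -> S) (c : T) f : T_span b f -> T_span b (ev th c * f).
Proof.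
move=> [t ->]; exists (fun i => c * t i); rewrite mulr_sumr.
by apply: eq_bigr => i _; rewrite rmorphM mulrA.
Qed.

(** A free subfamily is grown one element at a time. An element dependent on it enters the
    dependence with a nonzero coefficient, which is multiplied into the common denominator [c]. *)
Lemma almost_free_seq (gs : seq S) : exists k (b : 'I_k -> S) (c : T),
  [/\ T_free b, forall i, b i \in gs, c != 0 &
      forall g, g \in gs -> T_span b (ev th c * g)].
Proof.
elim: gs => [|x gs [k [b [c [fb bgs c0 spb]]]]].
  exists 0%N, (fun _ => 0), 1; split=> // [f _ []|[]|]; rewrite ?oner_neq0 //.
pose b' (i : 'I_k.+1) := if unlift ord_max i is Some j then b j else x.
have b'L j : b' (lift ord_max j) = b j by rewrite /b' liftK.
have b'M : b' ord_max = x by rewrite /b' unlift_none.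
have sumE (f : 'I_k.+1 -> T) : \sum_i ev th (f i) * b' i =
    \sum_i ev th (f (lift ord_max i)) * b i + ev th (f ord_max) * x.
  rewrite big_ord_recr /= b'M; congr (_ + _); apply: eq_bigr => i _.
  have -> : widen_ord (leqnSn k) i = lift ord_max i.
    by apply: val_inj; rewrite /= /bump leqNgt ltn_ord.
  by rewrite b'L.
case: (pselect (T_free b')) => [fb'|nfb'].
  exists k.+1, b', c; split=> // [i|g].
    rewrite /b'; case: unliftP => [j _|_]; last exact: mem_head.
    by rewrite inE bgs orbT.
  rewrite inE => /orP[/eqP->|/spb[t ->]].
    exists (fun i => if i == ord_max then c else 0); rewrite sumE eqxx big1 ?add0r //.
    by move=> i _; rewrite eq_sym (negbTE (neq_lift _ _)) raddf0 mul0r.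
  exists (fun i => if unlift ord_max i is Some j then t j else 0).
  rewrite sumE unlift_none raddf0 mul0r addr0; apply: eq_bigr => i _.
  by rewrite liftK.
have [f [f_rel nf]] : exists f : 'I_k.+1 -> T,
    \sum_i ev th (f i) * b' i = 0 /\ ~ (forall i, f i = 0).
  apply: contrapT => no_f; apply: nfb' => f f_rel; apply: contrapT => nf.
  by apply: no_f; exists f.
rewrite sumE in f_rel.
have fM0 : f ord_max != 0.
  apply/eqP => fM0; apply: nf => i; case: (unliftP ord_max i) => [j|] -> //.
  move: f_rel; rewrite fM0 raddf0 mul0r addr0.
  by move/(fb (fun i => f (lift ord_max i)))/(_ j).
exists k, b, (c * f ord_max); split=> //.
- by move=> i; rewrite inE bgs orbT.
- by rewrite mulf_neq0.
move=> g; rewrite inE => /orP[/eqP->|/spb sp].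
  rewrite rmorphM -mulrA; apply: T_spanM.
  exists (fun i => - f (lift ord_max i)); apply/eqP; rewrite -subr_eq0 -[X in _ == X]f_rel.
  rewrite addrC -sumrN; apply/eqP; congr (_ + _); apply: eq_bigr => i _.
  by rewrite raddfN mulNr opprK.
by rewrite [c * _]mulrC rmorphM -mulrA; apply: T_spanM.
Qed.

Lemma almost_free : exists k (b : 'I_k -> S) (c : T),
  [/\ T_free b, forall i, supp C (b i), c != 0 &
      forall m, C m -> T_span b (ev th c * 'X_[m])].
Proof.
have [k [b [c [fb bgs c0 sp]]]] := almost_free_seq [seq 'X_[m] | m <- low n1].
exists k, b, c; split=> // [i|m Cm].
  by have /mapP[m] := bgs i; rewrite mem_low => /andP[Cm _] ->; apply: suppX.
have [a ->] := finite_over_span fin_th (hpartX Cm).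
rewrite mulr_sumr big_seq; elim/big_rec: _ => [|x f]; first exact: T_span0.
rewrite mem_pairs mem_undup => /andP[xlow _] spf; apply: T_spanD => //.
have -> : ev th c * (a x *: gens th x) =
    ev th (a x *: 'X_[x.1]) * (ev th c * 'X_[x.2]).
  rewrite mmapZ mmapX mul_mpolyC /gens -!scalerAl -scalerAr; congr (_ *: _).
  by rewrite mulrCA.
by apply: T_spanM; apply: sp; apply: map_f.
Qed.

Context (a : nat).
Hypothesis C_bound : forall m, C m -> forall i, (m i <= a * dg m)%N.
Hypothesis C_sat : forall N m, (0 < N)%N -> C (m *+ N)%MM -> C m.

Lemma monoid_muln m k : C m -> C (m *+ k)%MM.
Proof. by move=> Cm; elim: k => [|k IH]; rewrite ?mulm0n // mulmS; apply: CD. Qed.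

Lemma monoid_sum (I : eqType) (r : seq I) (F : I -> 'X_{1..D}) :
  (forall i, i \in r -> C (F i)) -> C (\sum_(i <- r) F i)%MM.
Proof.
by move=> CF; rewrite big_seq; elim/big_rec: _ => // i x /CF; apply: CD.
Qed.

Lemma dgMn m k : dg (m *+ k)%MM = (dg m * k)%N.
Proof.
by elim: k => [|k IH]; rewrite ?mulm0n ?dg0 ?muln0 // mulmS dgD IH mulnS.
Qed.

(** Iterating [C_split] down to degree [n0] covers the monoid by finitely many translates of its
    submonoid generated in degree one. *)
Lemma monoid_decomp m : C m -> exists e (mu : 'X_{1..D} -> nat),
  [/\ C e, (dg e <= n0)%N & m = (e + \sum_(v <- Cs 1) (v *+ mu v))%MM].
Proof.
have [n] := ubnP (dg m); elim: n m => // n IH m lt_m Cm.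
case: (leqP (dg m) n0) => [le_m|lt_n0].
  exists m, (fun _ => 0%N); split=> //; rewrite big1 ?addm0 //.
have [v [m' [Cv Ev Cm' Em]]] := C_split Cm (ltnW lt_n0).
have [|//|e [mu [Ce le_e Em']]] := IH m'; first by move: lt_m; rewrite Em dgD Ev.
exists e, (fun u => (u == v) + mu u)%N; split=> //.
rewrite Em Em' addmC -addmA; congr (_ + _)%MM; apply/mnmP => i.
rewrite mnmDE !mnm_sumE; under eq_bigr => u _ do rewrite mulmnE.
under [RHS]eq_bigr => u _ do rewrite mulmnE mulnDr.
rewrite big_split /= addnC; congr (_ + _)%N.
rewrite (bigD1_seq v) //= ?mem_Cs ?Cv ?Ev // eqxx muln1 big1 ?addn0 // => u /negbTE->.
by rewrite muln0.
Qed.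

(* Otherwise Dickson's lemma gives [q < q'] and one [z] outside [C] such that
   [w + z *+ q'] exceeds [w + z *+ q] by an element of [C], contradicting
   saturation. *)
Lemma monoid_limit w j : C w -> exists Q : nat, forall q, (Q <= q)%N ->
  forall z, dg z = j -> C (w + z *+ q)%MM -> C z.
Proof.
move=> Cw; apply: contrapT => noQ.
have /choice[qz qzP] : forall k : nat, exists x : nat * 'X_{1..D},
    [/\ (k < x.1)%N, dg x.2 = j, C (w + x.2 *+ x.1)%MM & ~~ C x.2].
  move=> k; apply: contrapT => nok; apply: noQ; exists k.+1 => q lt_kq z Ez Cwz.
  by apply: contrapT => /negP nCz; apply: nok; exists (q, z).
have /choice[em emP] : forall k, exists x : 'X_{1..D} * ('X_{1..D} -> nat),
    [/\ C x.1, (dg x.1 <= n0)%N & (w + (qz k).2 *+ (qz k).1 =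
       x.1 + \sum_(v <- Cs 1) (v *+ x.2 v))%MM].
  move=> k; have [_ _ Ck _] := qzP k.
  by have [e [mu []]] := monoid_decomp Ck; exists (e, mu).
pose B := (a * (dg w + j) + a * n0)%N.
have z_le k i : ((qz k).2 i <= B)%N.
  have [lt_k Ej Ck _] := qzP k; have := C_bound Ck i.
  rewrite mnmDE mulmnE dgD dgMn Ej /B => le_zi.
  apply: leq_trans (leq_addr _ _).
  have q0 : (0 < (qz k).1)%N by apply: leq_ltn_trans lt_k.
  rewrite -(leq_pmul2r q0); apply: leq_trans (leq_addl (w i) _) _.
  by apply: leq_trans le_zi _; nia.
have e_le k i : ((em k).1 i <= B)%N.
  have [Ce le_e _] := emP k; apply: leq_trans (C_bound Ce i) _.
  by apply: leq_trans (leq_addl _ _); rewrite leq_mul2l le_e orbT.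
(* The bounded coordinates of [z] and [e] enter together with their complements to [B], so
   monotonicity makes them constant; only the multiplicities can grow. *)
pose f (x : 'I_(size (Cs 1)) + ('I_D * bool + 'I_D * bool)) k := match x with
  | inl i => (em k).2 (nth 0%MM (Cs 1) i)
  | inr (inl (i, s)) => if s then (qz k).2 i else (B - (qz k).2 i)%N
  | inr (inr (i, s)) => if s then (em k).1 i else (B - (em k).1 i)%N end.
have [phi [phiS phiP]] := nondecreasing_subseqs f.
have le_phi n : (n <= phi n)%N by elim: n => // n IH; apply: leq_ltn_trans (phiS n).
pose k := phi 0%N; pose k' := phi (qz k).1.
have lt_q : ((qz k).1 < (qz k').1)%N.
  have [lt_k' _ _ _] := qzP k'; apply: leq_ltn_trans lt_k'; exact: le_phi.
have mono x : (f x k <= f x k')%N by apply: phiP.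
have Ez : (qz k').2 = (qz k).2.
  apply/mnmP => i; have := mono (inr (inl (i, true))).
  by have := mono (inr (inl (i, false))) => /=; have := z_le k i; have := z_le k' i; lia.
have Ee : (em k').1 = (em k).1.
  apply/mnmP => i; have := mono (inr (inr (i, true))).
  by have := mono (inr (inr (i, false))) => /=; have := e_le k i; have := e_le k' i; lia.
have [_ _ _ /negP] := qzP k; apply.
apply: (@C_sat ((qz k').1 - (qz k).1)); first by rewrite subn_gt0.
have -> : ((qz k).2 *+ ((qz k').1 - (qz k).1) =
    \sum_(v <- Cs 1) (v *+ ((em k').2 v - (em k).2 v)))%MM.
  apply/mnmP => i; have [_ _ /mnmP/(_ i)] := emP k; have [_ _ /mnmP/(_ i)] := emP k'.
  rewrite Ez Ee !(mnmDE, mulmnE, mnm_sumE).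
  have -> : (\sum_(v <- Cs 1) (v *+ (em k').2 v)%MM i =
      \sum_(v <- Cs 1) (v *+ ((em k').2 v - (em k).2 v))%MM i +
      \sum_(v <- Cs 1) (v *+ (em k).2 v)%MM i)%N.
    rewrite -big_split /= big_seq [RHS]big_seq; apply: eq_bigr => v vC.
    rewrite !mulmnE -mulnDr subnK //; have vlt : (index v (Cs 1) < size (Cs 1))%N.
      by rewrite index_mem.
    by have := mono (inl (Ordinal vlt)); rewrite /= nth_index.
  by rewrite mulnBr; nia.
by apply: monoid_sum => v; rewrite mem_Cs => /andP[Cv _]; apply: monoid_muln.
Qed.

(** Here [f] may have terms of any degree, even outside [C]; as [h] has degree one, only its terms
    of degree [n - 1] reach a monomial of degree [n]. *)
Lemma mcoeffM_part n h f u :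
  hpart 1 h -> dg u = n ->
  (h * f)@_u =
  (h * \sum_(z <- msupp f | (dg z).+1 == n) f@_z *: 'X_[z])@_u.
Proof.
move=> Rh Eu; set g := \sum_(z <- _ | _) _.
have gE z : (dg z).+1 = n -> g@_z = f@_z.
  move=> Ez; rewrite [f in RHS]mpolyE /g !raddf_sum /= big_mkcond.
  apply: eq_bigr => y _; rewrite mcoeffZ mcoeffX; case: ifP => //.
  by case: (eqVneq y z) => [->|_]; rewrite ?mulr0 // Ez eqxx.
rewrite [h]mpolyE !mulr_suml !raddf_sum /= big_seq [RHS]big_seq.
apply: eq_bigr => v /Rh /andP[Cv /eqP Ev].
rewrite -!scalerAl !mcoeffZ !['X_[v] * _]mulrC !mcoeffMXE.
case: ifP => // le_vu; rewrite gE //.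
by rewrite -Eu -{2}(submK le_vu) dgD Ev addn1.
Qed.

Context (p : nat).
Hypothesis pcharK : p \in [pchar K].

(* The tight closure argument: the monoid algebra is strongly F-regular. *)
Lemma frobenius_descent (c : S) j : c != 0 -> supp C c ->
  exists Q : nat, forall q, (Q <= q)%N -> [pchar K]%R.-nat q ->
  forall e (s : 'I_d.+1 -> S), hpart j e -> (forall i, supp C (s i)) ->
    c * e ^+ q = \sum_i th i ^+ q * s i -> lideal th j e.
Proof.
move=> c0 Cc; pose w := mlead c; have wc : w \in msupp c by apply: mlead_supp.
have [Q QP] := monoid_limit j.-1 (Cc _ wc).
(* [Q] comes from [monoid_limit]; [msize c] keeps all exponents of [c] below [q], as the splitting
   requires. *)
exists (maxn Q (msize c)) => q; rewrite geq_max => /andP[le_Q le_c] pq e s Re Cs' E.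
have ltq m : m \in msupp c -> forall i, (m i < q)%N.
  move=> mc i; apply: leq_trans le_c; apply: leq_ltn_trans (msize_mdeg_lt mc).
  by rewrite mdegE (bigD1 i) //= leq_addr.
have q0 : (0 < q)%N by case: (q) pq.
have [pi [pi_supp pi_sum piM pi1]] := frobenius_splitting q0 pq wc ltq.
have Ee : e = \sum_i th i * pi (s i).
  rewrite -[LHS]mulr1 -pi1 -piM mulrC E pi_sum.
  by apply: eq_bigr => i _; rewrite piM.
(* [pi (s i)] need not lie in the algebra, but its terms of degree [j - 1] do: such a [z] comes from
   [w + z *+ q] in the support of [s i], and [monoid_limit] applies. *)
pose part f : S := \sum_(z <- msupp f | (dg z).+1 == j) f@_z *: 'X_[z].
exists (fun i => part (pi (s i))).
have Rpart i : hpartp j (part (pi (s i))).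
  rewrite /part big_seq_cond; apply: supp_sum => z /andP[zs /eqP Ez].
  apply: suppZ; apply: suppX => /=; rewrite Ez eqxx andbT.
  apply: (QP q le_Q); first by rewrite -Ez.
  by apply: (Cs' i); rewrite mcoeff_msupp; apply: pi_supp; rewrite -mcoeff_msupp.
split=> //; apply/mpolyP => u; case: (eqVneq (dg u) j) => [Eu|ne].
  rewrite Ee !raddf_sum; apply: eq_bigr => i _ /=.
  by apply: mcoeffM_part.
rewrite (supp_mcoeff Re) ?(supp_mcoeff (P := [pred m | C m && (dg m == j)])) //=.
- by apply: supp_sum => i _; apply: hpart1Mp.
- by rewrite (negbTE ne) andbF.
by rewrite (negbTE ne) andbF.
Qed.

Lemma supp_ev (g : T) : supp C (ev th g).
Proof.
rewrite /mmap; apply: supp_sum => m _; rewrite mul_mpolyC; apply: suppZ.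
by apply: supp_sub (hpart_mmap1 Rth) => u /andP[].
Qed.

Lemma supp_CM f g : supp C f -> supp C g -> supp C (f * g).
Proof. exact: suppM. Qed.

Section Independence.

Context (es : seq 'X_{1..D}).
Hypothesis es_uniq : uniq es.
Hypothesis C_es : forall m, m \in es -> C m.
Hypothesis es_indep : forall j (ka : 'X_{1..D} -> K),
  lideal th j (\sum_(m <- es | dg m == j) ka m *: 'X_[m]) ->
  forall m, m \in es -> dg m = j -> ka m = 0.

Lemma gens_indep n (ka : 'X_{1..d.+1} * 'X_{1..D} -> K) :
  \sum_(x <- pairs d.+1 es n) ka x *: gens th x = 0 ->
  forall x, x \in pairs d.+1 es n -> ka x = 0.
Proof.
move=> rel x1 x1P; apply: contrapT => /eqP ka1.
have exj : exists j, has (fun x => (ka x != 0) && (dg x.2 == j)) (pairs d.+1 es n).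
  by exists (dg x1.2); apply/hasP; exists x1; rewrite ?ka1 ?eqxx.
have ubj j : has (fun x => (ka x != 0) && (dg x.2 == j)) (pairs d.+1 es n) -> (j <= n)%N.
  case/hasP => x; rewrite mem_pairs => /andP[_ /eqP<-] /andP[_ /eqP<-].
  exact: leq_addl.
case: (ex_maxnP exj ubj) => j /hasP[[al0 m0]] /= x0P /andP[ka0 /eqP Em0] jmax.
have {}jmax x : x \in pairs d.+1 es n -> ka x != 0 -> (dg x.2 <= j)%N.
  by move=> xP kax; apply: jmax; apply/hasP; exists x; rewrite ?kax ?eqxx.
move: (x0P); rewrite mem_pairs /= => /andP[m0es /eqP En].
(* The total degree is [n], so maximality of [j] gives [al0] the least degree among the
   theta-exponents that occur; [e] is the factor of theta^al0 in the relation. *)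
pose e := \sum_(m <- es | dg m == j) ka (al0, m) *: 'X_[m] : S.
suff Je : lideal th j e.
  by move/eqP: ka0; apply; apply: (es_indep Je m0es Em0).
have Re : hpart j e.
  rewrite /e big_seq_cond; apply: supp_sum => m /andP[mes Em].
  by apply: suppZ; apply: suppX => /=; rewrite C_es.
have [k [b [c [fb Cb c0 sp]]]] := almost_free.
have ec0 : ev th c != 0 by apply: contra_neq c0; apply: ev_inj.
have [Q QP] := frobenius_descent j ec0 (@supp_ev c).
have p_gt1 : (1 < p)%N by apply: prime_gt1; apply: pcharf_prime pcharK.
pose q := (p ^ Q)%N.
have pq : [pchar K]%R.-nat q.
  rewrite pnatX; apply/orP; left; rewrite pnatE //; exact: pcharf_prime pcharK.
have q0 : (0 < q)%N by rewrite expn_gt0 ltnW.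
have le_Q : (Q <= q)%N by apply/ltnW/ltn_expl.
have pqS : [pchar S]%R.-nat q by apply: sub_in_pnat pq => r _; rewrite pchar_lalg.
have /choice[t tP] : forall m, exists t : 'I_k -> T, m \in es ->
    ev th c * 'X_[m] ^+ q = \sum_i ev th (t i) * b i.
  move=> m; case: (boolP (m \in es)) => [mes|_]; last by exists (fun _ => 0).
  by have [t E] := sp _ (monoid_muln q (C_es mes)); exists t; rewrite mpolyXn.
have Xq (m : 'X_{1..d.+1}) : mmap1 th m ^+ q = ev th 'X_[m *+ q].
  by rewrite -mpolyXn rmorphXn /= mmapX.
(* The [q]-th power of the relation, times [c], is expanded in the free family [b]; each coordinate
   is a relation in [T]. *)
have rel_i i : \sum_(x <- pairs d.+1 es n) (ka x ^+ q *: 'X_[x.1 *+ q]) * t x.2 i = 0 :> T.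
  move: i; apply: fb.
  have := congr1 (fun f => ev th c * f ^+ q) rel.
  rewrite expr0n gtn_eqF // mulr0 exprDn_sum // mulr_sumr => E.
  rewrite -[RHS]E; under eq_bigr => i _ do rewrite raddf_sum mulr_suml.
  rewrite exchange_big /= big_seq [RHS]big_seq; apply: eq_bigr => x.
  rewrite mem_pairs => /andP[xes _].
  rewrite exprZn /gens exprMn -scalerAr mulrCA (tP _ xes) mulr_sumr scaler_sumr.
  apply: eq_bigr => i _; rewrite rmorphM /= mmapZ mul_mpolyC Xq.
  by rewrite -!scalerAl mulrA.
pose tt i : T := \sum_(m <- es | dg m == j) ka (al0, m) ^+ q *: t m i.
(* At the exponent [al0 *+ q + r] only terms with [x.1 <= al0] componentwise contribute, and the
   least degree of [al0] forces [x.1 = al0]. *)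
have tt0 i (r : 'X_{1..d.+1}) : (forall l, r l < q)%N -> (tt i)@_r = 0.
  move=> ltr; have := congr1 (mcoeff (al0 *+ q + r)%MM) (rel_i i).
  rewrite mcoeff0 raddf_sum /= => E; rewrite -[RHS]E /tt raddf_sum /=.
  transitivity (\sum_(x <- pairs d.+1 es n | x.1 == al0) ka x ^+ q * (t x.2 i)@_r).
    rewrite -big_filter -[RHS]big_filter.
    rewrite (perm_big [seq (al0, m) | m <- [seq m <- es | dg m == j]]) /=.
      by rewrite big_map; apply: eq_bigr => m _; rewrite mcoeffZ.
    apply: uniq_perm; rewrite ?filter_uniq ?pairs_uniq //.
      by rewrite map_inj_uniq ?filter_uniq // => m m' [].
    move=> [al m]; rewrite mem_filter mem_pairs /=.
    apply/andP/mapP => [[/eqP-> /andP[mes /eqP E']]|[m']].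
      exists m => //; rewrite mem_filter mes andbT.
      by rewrite -(eqn_add2l (mdeg al0)) E' -En Em0.
    by rewrite mem_filter => /andP[/eqP Em' m'es] [-> ->]; rewrite eqxx m'es /= Em' -En Em0.
  rewrite big_mkcond big_seq [RHS]big_seq; apply: eq_bigr => x xP.
  rewrite -scalerAl mcoeffZ ['X_[_] * _]mulrC mcoeffMXE.
  case: (eqVneq x.1 al0) => [->|ne].
    by rewrite lem_addr addmC addmK.
  case: (eqVneq (ka x) 0) => [->|kax]; first by rewrite expr0n gtn_eqF // mul0r.
  case: ifP => [/mnm_lepP le|]; last by rewrite mulr0.
  case/eqP: ne; apply/mnmP.
  have le_al l : (x.1 l <= al0 l)%N.
    by have := le l; rewrite mnmDE !mulmnE -leq_divRL // divnMDl // divn_small ?addn0.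
  have := jmax _ xP kax; move: xP; rewrite mem_pairs => /andP[_ /eqP Ex] le_j.
  have le_deg : (mdeg al0 <= mdeg x.1)%N.
    by rewrite -(leq_add2r (dg x.2)) Ex -En leq_add2l Em0.
  move=> l; apply/eqP; rewrite eqn_leq le_al leqNgt; apply/negP => lt_l.
  move: le_deg; apply/negP; rewrite -ltnNge !mdegE (bigD1 l) //= [ltnRHS](bigD1 l) //=.
  by rewrite -addSn leq_add // leq_sum.
(* Hence each [tt i] lies in the ideal of the [q]-th powers of the variables, and [c * e ^+ q] in
   that of the [th l ^+ q], as [frobenius_descent] asks. *)
have /choice[s sP] i := mpoly_in_powers (tt0 i).
apply: (QP q le_Q pq _ (fun l => \sum_i ev th (s i l) * b i) Re).
  by move=> l; apply: supp_sum => i _; apply: supp_CM; [apply: supp_ev | apply: Cb].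
rewrite /e exprDn_sum // mulr_sumr.
transitivity (\sum_i ev th (tt i) * b i).
  under [RHS]eq_bigr => i _ do rewrite raddf_sum mulr_suml.
  rewrite exchange_big /= big_seq_cond [RHS]big_seq_cond.
  apply: eq_bigr => m /andP[mes _]; rewrite exprZn -scalerAr (tP _ mes) scaler_sumr.
  by apply: eq_bigr => i _; rewrite mmapZ mul_mpolyC scalerAl.
under eq_bigr => i _ do rewrite sP raddf_sum mulr_suml.
rewrite exchange_big; apply: eq_bigr => l _ /=; rewrite mulr_sumr.
by apply: eq_bigr => i _; rewrite rmorphM rmorphXn /= mmapX mmap1U mulrA.
Qed.

End Independence.

(** * Bases modulo the parameters and the Hilbert function *)

Lemma basis_mod n (ms : seq 'X_{1..D}) : uniq ms ->
  exists E : seq 'X_{1..D}, [/\ uniq E, {subset E <= ms},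
    forall ka : 'X_{1..D} -> K, lideal th n (\sum_(m <- E) ka m *: 'X_[m]) ->
      forall m, m \in E -> ka m = 0 &
    forall m, m \in ms -> exists ka : 'X_{1..D} -> K,
      lideal th n ('X_[m] - \sum_(m' <- E) ka m' *: 'X_[m'])].
Proof.
elim: ms => [_|x ms IH] /=; first by exists [::]; split.
case/andP => xms /IH[E [uE Ems indE spE]].
case: (pselect (exists ka : 'X_{1..D} -> K,
    lideal th n ('X_[x] - \sum_(m' <- E) ka m' *: 'X_[m']))) => [spx|nspx].
  exists E; split=> // [m /Ems|m]; first by rewrite inE orbC => ->.
  by rewrite inE => /orP[/eqP->|/spE].
have xE : x \notin E by apply: contra xms => /Ems.
exists (x :: E); split=> /= [|m|ka|m].
- by rewrite xE.
- by rewrite !inE => /orP[->|/Ems->]; rewrite ?orbT.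
- rewrite big_cons => Jka; case: (eqVneq (ka x) 0) => [kax|kax].
    move=> m; rewrite inE => /orP[/eqP->//|]; apply: indE.
    by move: Jka; rewrite kax scale0r add0r.
  case: nspx; exists (fun m => - (ka x)^-1 * ka m).
  rewrite -sumrN; under eq_bigr => m _ do rewrite -scaleNr mulNr opprK -scalerA.
  rewrite -scaler_sumr; move/(lidealZ (ka x)^-1): Jka.
  by rewrite scalerDr scalerA mulVf // scale1r.
rewrite inE => /orP[/eqP->|/spE[ka Jka]].
  exists (fun m => (m == x)%:R); rewrite big_cons eqxx scale1r opprD addrA subrr.
  rewrite big_seq big1 ?oppr0 ?addr0; first exact: lideal0.
  by move=> u yE; rewrite (negbTE (memPn xE u yE)) scale0r.
exists (fun m => if m == x then 0 else ka m); rewrite big_cons eqxx scale0r add0r.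
rewrite (eq_big_seq (fun u => ka u *: 'X_[u])) // => u yE.
by rewrite (negbTE (memPn xE u yE)).
Qed.

Lemma quotient_bases : exists E : nat -> seq 'X_{1..D}, forall n,
  [/\ uniq (E n), {subset E n <= Cs n},
    forall ka : 'X_{1..D} -> K, lideal th n (\sum_(m <- E n) ka m *: 'X_[m]) ->
      forall m, m \in E n -> ka m = 0 &
    forall m, m \in Cs n -> exists ka : 'X_{1..D} -> K,
      lideal th n ('X_[m] - \sum_(m' <- E n) ka m' *: 'X_[m'])].
Proof.
have /choice[E EP] n := basis_mod n (Cs_uniq n).
by exists E.
Qed.

Section Hilbert.

Context (E : nat -> seq 'X_{1..D}).
Hypothesis EP : forall n, [/\ uniq (E n), {subset E n <= Cs n},
    forall ka : 'X_{1..D} -> K, lideal th n (\sum_(m <- E n) ka m *: 'X_[m]) ->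
      forall m, m \in E n -> ka m = 0 &
    forall m, m \in Cs n -> exists ka : 'X_{1..D} -> K,
      lideal th n ('X_[m] - \sum_(m' <- E n) ka m' *: 'X_[m'])].

Definition basis n := flatten [seq E j | j <- iota 0 n.+1].

Lemma bases_Cs n m : m \in E n -> C m /\ dg m = n.
Proof. by have [_ sE _ _] := EP n; move/sE; rewrite mem_Cs => /andP[? /eqP]. Qed.

Lemma mem_basis n m : (m \in basis n) = (m \in E (dg m)) && (dg m <= n)%N.
Proof.
apply/flatten_mapP/andP => [[j]|[mE le_m]].
  by rewrite mem_iota => lt_j mE; have [_ ->] := bases_Cs mE.
by exists (dg m) => //; rewrite mem_iota.
Qed.

Lemma basis_uniq n : uniq (basis n).
Proof.
have : uniq (iota 0 n.+1) := iota_uniq _ _.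
rewrite /basis; elim: (iota _ _) => //= j s IH /andP[js us].
rewrite cat_uniq IH // andbT; have [-> _ _ _] := EP j.
apply/hasPn => m /flatten_mapP[i i_s mEi]; apply: contra js => mEj.
by have [_ <-] := bases_Cs mEj; have [_ ->] := bases_Cs mEi.
Qed.

Lemma big_basis n (F : 'X_{1..D} -> S) j : (j <= n)%N ->
  \sum_(m <- basis n | dg m == j) F m = \sum_(m <- E j) F m.
Proof.
move=> le_j; rewrite -big_filter; apply: perm_big; apply: uniq_perm.
- by rewrite filter_uniq // basis_uniq.
- by have [] := EP j.
move=> m; rewrite mem_filter mem_basis; apply/andP/idP.
  by case=> /eqP-> /andP[].
by move=> mE; have [_ Em] := bases_Cs mE; rewrite Em eqxx mE.
Qed.

(** The induction of [finite_over_span] again, now with lifts of a basis of the quotient, which span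
    modulo the ideal in every degree. *)
Lemma basis_span n n' f : (n' <= n)%N -> hpart n' f ->
  in_span (pairs d.+1 (basis n) n') (gens th) f.
Proof.
elim/ltn_ind: n' f => n' IH f le_n Rf.
have spJ g : lideal th n' g -> in_span (pairs d.+1 (basis n) n') (gens th) g.
  apply: in_span_lideal => [|h Rh]; first exact: basis_uniq.
  case: n' IH le_n Rh {f g Rf} => [|n'] IH le_n Rh; last first.
    by apply: (IH n' _ h (ltnW le_n)) => //; apply: hpartp_predn Rh.
  by rewrite (hpartp0 Rh); apply: in_span0.
rewrite (hpart_expand Rf); apply: in_span_sum => m mC; apply: in_spanZ.
have [_ _ _ /(_ m mC)[ka /spJ sp]] := EP n'.
rewrite -(subrK (\sum_(m' <- E n') ka m' *: 'X_[m']) 'X_[m]); apply: in_spanD => //.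
apply: in_span_sum => u uE; apply: in_spanZ; have [Cu Eu] := bases_Cs uE.
have -> : 'X_[u] = gens th (0%MM, u) by rewrite /gens mmap11 mul1r.
apply: in_span_mem; first by rewrite pairs_uniq // basis_uniq.
by rewrite mem_pairs mem_basis Eu uE le_n mdeg0 add0n eqxx.
Qed.

Lemma basis_gens_indep n n' (ka : 'X_{1..d.+1} * 'X_{1..D} -> K) :
  \sum_(x <- pairs d.+1 (basis n) n') ka x *: gens th x = 0 ->
  forall x, x \in pairs d.+1 (basis n) n' -> ka x = 0.
Proof.
apply: gens_indep; first exact: basis_uniq.
  by move=> m; rewrite mem_basis => /andP[/bases_Cs[]].
move=> j kb Jj m; rewrite mem_basis => /andP[mE le_m] Em; subst j.
by move: Jj; rewrite big_basis // => Jj; have [_ _ indE _] := EP (dg m); apply: indE Jj _ _.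
Qed.

Lemma size_pairs_basis n k : (n <= k)%N -> size (pairs d.+1 (basis n) k) =
  (\sum_(j < n.+1) size (E j) * 'C(k - j + d, d))%N.
Proof.
move=> le_nk; rewrite size_pairs /basis big_flatten big_map.
rewrite -[iota 0 n.+1]/(index_iota 0 n.+1) big_mkord; apply: eq_bigr => j _.
rewrite big_seq_cond (eq_bigr (fun _ => 'C(k - j + d, d))) => [|m /andP[/bases_Cs[_ ->]]] //.
rewrite (eq_bigl (fun m => m \in E j)) -?big_seq => [|m].
  by rewrite big_const_seq count_predT iter_addn_0 mulnC.
case: (boolP (m \in E j)) => // mE; have [_ ->] := bases_Cs mE.
by rewrite (leq_trans _ le_nk) // -ltnS.
Qed.

(** The monomials of [Cs n] and the products indexed by [pairs] are two bases of the degree [n]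
    part; counting both makes the [size (E j)] the coefficients of the numerator. *)
Lemma hilbert_function n :
  size (Cs n) = (\sum_(j < n.+1) size (E j) * 'C(n - j + d, d))%N.
Proof.
rewrite -size_pairs_basis //; apply/eqP; rewrite eqn_leq; apply/andP; split.
  apply: (@indep_span_leq K S _ _ _ _ (fun m => 'X_[m]) (gens th)).
  - exact: Cs_uniq.
  - exact: Cs_indep.
  move=> m; rewrite mem_Cs => /andP[Cm /eqP Em].
  by apply: basis_span => //; rewrite -Em; apply: hpartX.
apply: (@indep_span_leq K S _ _ _ _ (gens th) (fun m => 'X_[m])).
- by rewrite pairs_uniq // basis_uniq.
- exact: basis_gens_indep.
move=> x; rewrite mem_pairs mem_basis => /andP[/andP[/bases_Cs[Cx _] _] /eqP Ex].
exists (fun u => (gens th x)@_u); apply: hpart_expand; rewrite -Ex /gens.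
by apply: hpartM; [apply: hpart_mmap1 | apply: hpartX].
Qed.

(** * Absence of gaps in the numerator *)

Context (w : 'X_{1..D}).
Hypothesis Cw : C w.
Hypothesis conductor : forall m, C m ->
  exists2 s : seq 'X_{1..D}, {subset s <= Cs 1} & (w + m = \sum_(v <- s) v)%MM.

Lemma degree1_exists : exists v, v \in Cs 1.
Proof.
have := Cs_lower n0; case E0 : (Cs (n0 * M1)) => [|m ms] /= le_bin.
  by have := bin_gt0 (n0 + d) d; rewrite leq_addl => /leq_trans/(_ le_bin).
have := mem_head m ms; rewrite -E0 mem_Cs => /andP[Cm /eqP Em].
have [|v [_ [Cv Ev _ _]]] := C_split Cm; first by rewrite Em leq_pmulr.
by exists v; rewrite mem_Cs Cv Ev.
Qed.

(* If [E m] is empty then [hpart m] is [lideal th m], so the [T]-module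
   generated by [hpart m.-1] is stable under multiplication by [hpart 1]; by the
   conductor it contains a translate of the whole algebra, so it has full rank. *)
Lemma no_gap (m s : nat) : (0 < m)%N -> E m = [::] -> (m <= s)%N -> E s = [::].
Proof.
case: m => // m _ Em le_ms; apply/eqP; rewrite -size_eq0 -leqn0 leqNgt; apply/negP => gs.
have RJ f : hpart m.+1 f -> lideal th m.+1 f.
  move=> Rf; rewrite (hpart_expand Rf) big_seq; elim/big_rec: _ => [|u x uC Jx].
    exact: lideal0.
  apply: lidealD => //; apply: lidealZ; have [_ _ _ /(_ u uC)[ka]] := EP m.+1.
  by rewrite Em big_nil subr0.
(* The gap is now at [m.+1]. [mod_gen l] is the degree [m + l] part of the K[theta]-module generated
   by [hpart m], built by one theta factor at a time. *)
pose fix mod_gen (l : nat) (f : S) {struct l} : Prop := if l is l'.+1 then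
  exists r : 'I_d.+1 -> S, (forall i, mod_gen l' (r i)) /\ f = \sum_i th i * r i
  else hpart m f.
have genX v l f : v \in Cs 1 -> mod_gen l f -> mod_gen l.+1 ('X_[v] * f).
  rewrite mem_Cs => /andP[Cv /eqP Ev]; elim: l f => [|l IH] f /=.
    move=> Rf; have [|r [Rr ->]] := RJ ('X_[v] * f).
      by rewrite -add1n -Ev; apply: hpartM => //; apply: hpartX.
    by exists r; split=> // i; apply: hpartp_predn (Rr i).
  move=> [r [Rr ->]]; exists (fun i => 'X_[v] * r i); split=> [i|]; first exact: IH.
  by rewrite mulr_sumr; apply: eq_bigr => i _; rewrite mulrCA.
have gen_span l f : mod_gen l f -> in_span (pairs d.+1 (basis m) (m + l)%N) (gens th) f.
  elim: l f => [|l IH] f /=; first by rewrite addn0; apply: basis_span.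
  move=> [r [Rr ->]]; apply: in_span_sum => i _; rewrite addnS.
  by apply: in_span_th; [apply: basis_uniq | apply: IH].
have [v vC] := degree1_exists; move: (vC); rewrite mem_Cs => /andP[Cv /eqP Ev].
pose u := (v *+ m)%MM.
have Ru : hpart m 'X_[u] by have := hpartX (monoid_muln m Cv); rewrite dgMn Ev mul1n.
have gen_sum (l : seq 'X_{1..D}) : {subset l <= Cs 1} ->
    mod_gen (size l) ('X_[\sum_(x <- l) x] * 'X_[u]).
  elim: l => [_|x l IH sl]; first by rewrite big_nil mpolyX0 mul1r.
  rewrite big_cons mpolyXD -mulrA; apply: genX; first by apply: sl; apply: mem_head.
  by apply: IH => y yl; apply: sl; rewrite inE yl orbT.
have dg_sum (l : seq 'X_{1..D}) : {subset l <= Cs 1} ->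
    dg (\sum_(x <- l) x)%MM = size l.
  elim: l => [_|x l IH sl]; first by rewrite big_nil dg0.
  rewrite big_cons dgD IH => [|y yl]; last by apply: sl; rewrite inE yl orbT.
  by have := sl x (mem_head _ _); rewrite mem_Cs => /andP[_ /eqP->].
(* Translation by [w + u] embeds degree [n] of the algebra into degree [n + (m + dg w)] of this
   module, whose generators have degree at most [m]; [g s > 0] makes the algebra grow too fast for
   that. *)
apply: (@hilbert_growth d m.+1 s (m + dg w) (fun j => size (E j)) le_ms gs) => n.
rewrite -hilbert_function; have -> : (\sum_(j < m.+1) size (E j) *
    'C(n + (m + dg w) - j + d, d))%N = size (pairs d.+1 (basis m) (n + (m + dg w))).
  by rewrite size_pairs_basis //; lia.
apply: (@indep_span_leq K S _ _ _ _ (fun z => 'X_[w + z] * 'X_[u]) (gens th)).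
- exact: Cs_uniq.
- move=> ka rel; apply: Cs_indep; apply/eqP.
  have : 'X_[w] * 'X_[u] * (\sum_(z <- Cs n) ka z *: 'X_[z]) == 0 :> S.
    apply/eqP; rewrite -[RHS]rel mulr_sumr; apply: eq_bigr => z _.
    by rewrite -scalerAr mpolyXD; congr (_ *: _); rewrite mulrAC.
  by rewrite !mulf_eq0 -!msupp_eq0 !msuppX.
move=> z; rewrite mem_Cs => /andP[Cz /eqP Ez].
have [l sl El] := conductor Cz.
have := gen_span _ _ (gen_sum l sl); rewrite -El.
by rewrite -(dg_sum l sl) -El dgD Ez (_ : (m + (dg w + n) = n + (m + dg w))%N) //; lia.
Qed.

End Hilbert.

End MonoidAlgebra.

Lemma hilbert_no_gap (D d : nat) (dg : 'X_{1..D} -> nat) (C : pred 'X_{1..D})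
    (Cs : nat -> seq 'X_{1..D}) (n0 A M0 M1 a : nat) (w : 'X_{1..D}) :
  (forall m m', dg (m + m')%MM = (dg m + dg m')%N) ->
  C 0%MM -> (forall m m', C m -> C m' -> C (m + m')%MM) ->
  (forall n, uniq (Cs n)) ->
  (forall n m, (m \in Cs n) = C m && (dg m == n)) ->
  (forall m, C m -> (n0 <= dg m)%N ->
     exists v m', [/\ C v, dg v = 1%N, C m' & m = (v + m')%MM]) ->
  (forall n, size (Cs n) <= A * (M0 * n.+1) ^ d)%N ->
  (0 < M1)%N -> (forall k, 'C(k + d, d) <= size (Cs (k * M1)))%N ->
  (forall m, C m -> forall i, (m i <= a * dg m)%N) ->
  (forall N m, (0 < N)%N -> C (m *+ N)%MM -> C m) ->
  C w ->
  (forall m, C m -> exists2 s : seq 'X_{1..D},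
     {subset s <= Cs 1%N} & (w + m = \sum_(v <- s) v)%MM) ->
  exists g : nat -> nat,
    (forall n, size (Cs n) = \sum_(j < n.+1) g j * 'C(n - j + d, d))%N /\
    (forall m s, (0 < m)%N -> g m = 0%N -> (m <= s)%N -> g s = 0%N).
Proof.
move=> dgD C0 CD Csu mCs Csp Cup M1p Clo Cbd Csat Cw cond.
have [K [iota _]] := countable_algebraic_closure 'F_2.
have pK : 2%N \in [pchar K] by apply: (rmorph_pchar iota); apply: pchar_Fp.
have [th [n1 [Rth fin]]] :=
  @noether_normalization K D dg C dgD C0 CD d Cs Csu mCs n0 A M0 Csp Cup.
have [E EP] := @quotient_bases K D dg C d Cs Csu th.
exists (fun j => size (E j)); split=> [n|m s m0 /size0nil Em le_ms].
  exact: (hilbert_function dgD C0 CD Csu mCs Csp M1p Clo Rth fin Cbd Csat pK EP).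
by rewrite (no_gap dgD C0 CD Csu mCs Csp M1p Clo Rth fin Cbd Csat pK EP Cw cond m0 Em le_ms).
Qed.

(** * The cone over a lattice polytope *)

Section Cone.

Context (R : realType) (d : nat) (vs : seq 'rV[int]_d).
Implicit Types (z v : 'rV[int]_d) (k n : nat).

Local Notation emb := (@of_lattice R d).

(** The slice at height [k] of the cone over the convex hull of [vs], written without division by
    [k]; at height zero it is the origin. *)
Definition cone k z := exists a : 'rV[int]_d -> R,
  [/\ forall v, 0 <= a v, \sum_(v <- vs) a v = k%:R &
      emb z = \sum_(v <- vs) a v *: emb v].

Lemma of_latticeE z j : emb z 0 j = (z 0 j)%:~R.
Proof. by rewrite mxE. Qed.

Lemma of_latticeD z z' : emb (z + z') = emb z + emb z'.
Proof. by apply/rowP => j; rewrite !mxE rmorphD. Qed.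

Lemma of_latticeMn z n : emb (z *+ n) = n%:R *: emb z.
Proof.
elim: n => [|n IH]; last by rewrite mulrS of_latticeD IH -natr1 scalerDl scale1r addrC.
by rewrite mulr0n scale0r; apply/rowP => j; rewrite !mxE.
Qed.

Lemma cone0 : cone 0 0.
Proof.
exists (fun _ => 0); split=> //; first by rewrite big1.
by rewrite big1 => [|v _]; rewrite ?scale0r //; apply/rowP => j; rewrite !mxE.
Qed.

Lemma coneD k k' z z' : cone k z -> cone k' z' -> cone (k + k')%N (z + z').
Proof.
move=> [a [a0 sa Ea]] [b [b0 sb Eb]]; exists (fun v => a v + b v); split.
- by move=> v; apply: addr_ge0.
- by rewrite big_split /= sa sb natrD.
rewrite of_latticeD Ea Eb -big_split; apply: eq_bigr => v _.
by rewrite scalerDl.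
Qed.

Lemma cone_sat k N z : (0 < N)%N -> cone (k * N)%N (z *+ N) -> cone k z.
Proof.
move=> N0 [a [a0 sa Ea]]; have NR : N%:R != 0 :> R by rewrite pnatr_eq0 -lt0n.
exists (fun v => N%:R^-1 * a v); split.
- by move=> v; rewrite mulr_ge0 // invr_ge0 ler0n.
- by rewrite -mulr_sumr sa natrM mulrC mulfK.
under eq_bigr => v _ do rewrite -scalerA.
by rewrite -scaler_sumr -Ea of_latticeMn scalerA mulVf // scale1r.
Qed.

Lemma cone1 v : uniq vs -> v \in vs -> cone 1 v.
Proof.
move=> us v_vs; exists (fun u => (u == v)%:R); split=> [u|| ].
- by rewrite ler0n.
- by rewrite (bigD1_seq v) //= eqxx big1 ?addr0 // => u /negbTE->.
rewrite (bigD1_seq v) //= eqxx scale1r big1 ?addr0 // => u /negbTE->.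
by rewrite scale0r.
Qed.

(** A total weight above [size vs] leaves some point with weight at least one, and that point can be
    subtracted. *)
Lemma cone_split k z : uniq vs -> (size vs < k)%N -> cone k z ->
  exists2 v, v \in vs & cone k.-1 (z - v).
Proof.
move=> us lt_k [a [a0 sa Ea]].
have [v v_vs av] : exists2 v, v \in vs & 1 <= a v.
  apply: contrapT => no_v; move: lt_k; rewrite ltnNge => /negP; apply.
  rewrite -(ler_nat R) -sa -sum1_size natr_sum big_seq [leRHS]big_seq.
  apply: ler_sum => v v_vs; rewrite leNgt; apply/negP => av.
  by apply: no_v; exists v => //; apply: ltW.
exists v => //; exists (fun u => a u - (u == v)%:R); split.
- move=> u; case: eqP => [->|_]; last by rewrite subr0.
  by rewrite subr_ge0.
- rewrite sumrB sa (bigD1_seq v) //= eqxx big1 => [|u /negbTE->//].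
  by rewrite addr0 -subn1 natrB //; apply: leq_ltn_trans lt_k.
under eq_bigr => u _ do rewrite scalerBl.
rewrite sumrB -Ea (bigD1_seq v) //= eqxx scale1r big1 => [|u /negbTE->]; last first.
  by rewrite scale0r.
by rewrite addr0; apply/rowP => j; rewrite !mxE rmorphB.
Qed.

Definition radius := (\sum_(v <- vs) \sum_j `|v 0%R j|)%N.

Lemma cone_bound k z j : cone k z -> `|z 0 j| <= (k * radius)%:Z.
Proof.
move=> [a [a0 sa Ea]]; rewrite -(ler_int R) intr_norm -of_latticeE Ea.
rewrite summxE; apply: le_trans (ler_norm_sum _ _ _) _.
apply: (@le_trans _ _ (\sum_(v <- vs) a v * radius%:R)); last first.
  by rewrite -mulr_suml sa -natrM -pmulrn.
rewrite big_seq [leRHS]big_seq; apply: ler_sum => v v_vs.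
rewrite mxE normrM ger0_norm // ler_wpM2l // of_latticeE -intr_norm.
rewrite -abszE -pmulrn ler_nat /radius (big_rem v) //= (bigD1 j) //=.
by rewrite -addnA leq_addr.
Qed.

Lemma shift_ge0 k z j : cone k z -> 0 <= z 0 j + (k * radius)%:Z.
Proof.
move/(cone_bound j); rewrite ler_norml => /andP[le_z _].
by rewrite -lerBlDr sub0r.
Qed.

Definition box k : seq 'rV[int]_d :=
  [seq \row_j ((f j)%:Z - (k * radius)%:Z) |
    f : {ffun 'I_d -> 'I_(2 * (k * radius)).+1} <- enum {ffun _ -> _}].

Lemma size_box k : size (box k) = ((2 * (k * radius)).+1 ^ d)%N.
Proof. by rewrite size_map -cardE card_ffun !card_ord. Qed.

Lemma cone_box k z : cone k z -> z \in box k.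
Proof.
move=> c; have lt_B j : (absz (z 0%R j + (k * radius)%:Z)%R < (2 * (k * radius)).+1)%N.
  rewrite ltnS -lez_nat gez0_abs ?shift_ge0 // mul2n -addnn PoszD lerD2r.
  by have := cone_bound j c; rewrite ler_norml => /andP[].
apply/mapP; exists [ffun j => Ordinal (lt_B j)]; first by rewrite mem_enum.
apply/rowP => j; rewrite mxE ffunE /=.
by rewrite gez0_abs ?addrK //; apply: shift_ge0.
Qed.

Lemma finite_cone k : finite_set [set z | cone k z]%classic.
Proof.
apply: (@sub_finite_set _ _ [set` box k]%classic) => [z /cone_box //|].
exact: finite_seq.
Qed.

Lemma lattice_points_dilate (P : set 'rV[R]_d) (V : set 'rV[int]_d) k z :
  uniq vs -> (forall v, v \in vs <-> V v) -> vs != [::] ->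
  P = convex_hull [set emb v | v in V]%classic ->
  lattice_points (dilate k P) z <-> cone k z.
Proof.
move=> us mem_vs vs0 ->; split.
  move=> [x [n [p [a [pV a0 sa ->]]]] Ez].
  have /choice[v vP] i : exists v, v \in vs /\ p i = emb v.
    by have [v /mem_vs v_vs <-] := pV i; exists v.
  (* The points [v i] may repeat, so the weight of [u] collects all [a i] with [v i = u]. The
     identity serves for the total weight and for the point. *)
  have sumE (W : lmodType R) (F : 'rV[int]_d -> W) :
      \sum_(u <- vs) (\sum_(i < n | v i == u) a i) *: F u = \sum_(i < n) a i *: F (v i).
    under eq_bigr => u _ do rewrite big_mkcond scaler_suml.
    rewrite exchange_big; apply: eq_bigr => i _ /=.
    rewrite (bigD1_seq (v i)) //=; last by have [] := vP i.
    rewrite eqxx big1 ?addr0 // => u; rewrite eq_sym => /negbTE->.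
    by rewrite scale0r.
  exists (fun u => k%:R * \sum_(i < n | v i == u) a i); split.
  - by move=> u; rewrite mulr_ge0 ?ler0n // sumr_ge0.
  - rewrite -mulr_sumr; have := sumE R^o (fun _ => 1).
    under eq_bigr => u _ do rewrite [_ *: _]mulr1.
    under [RHS]eq_bigr => i _ do rewrite [_ *: _]mulr1.
    by move=> ->; rewrite sa mulr1.
  rewrite -Ez; under [RHS]eq_bigr => u _ do rewrite -scalerA.
  rewrite -scaler_sumr sumE; congr (_ *: _); apply: eq_bigr => i _.
  by have [_ ->] := vP i.
move=> [a [a0 sa Ea]]; rewrite /lattice_points /dilate /=.
(* Height zero admits no division: there all weights on [vs] vanish, and a point of [vs] witnesses
   that [P] is nonempty. *)
case: k sa => [|k] sa.
  case: (vs) vs0 mem_vs => // v0 vs' _ mem_vs'.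
  exists (emb v0).
    exists 1%N, (fun _ => emb v0), (fun _ => 1); split=> //.
    - by move=> _; exists v0 => //; apply/mem_vs'; apply: mem_head.
    - by rewrite big_ord1.
    by rewrite big_ord1 scale1r.
  rewrite scale0r Ea big_seq big1 // => v v_vs.
  have /eqP := sa; rewrite big_seq psumr_eq0 // => /allP/(_ v v_vs).
  by rewrite v_vs => /eqP->; rewrite scale0r.
have k0 : k.+1%:R != 0 :> R by rewrite pnatr_eq0.
exists (k.+1%:R^-1 *: emb z); last by rewrite scalerA divff // scale1r.
exists (size vs), (fun i => emb (tnth (in_tuple vs) i)).
exists (fun i => k.+1%:R^-1 * a (tnth (in_tuple vs) i)); split.
- by move=> i; exists (tnth (in_tuple vs) i) => //; apply/mem_vs; apply: mem_tnth.
- by move=> i; rewrite mulr_ge0 // invr_ge0 ler0n.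
- by rewrite -mulr_sumr -(big_tnth _ _ _ xpredT a) sa mulVf.
under eq_bigr => i _ do rewrite -scalerA.
by rewrite -scaler_sumr Ea big_tnth.
Qed.

End Cone.

(** * The cone as a monoid of exponent vectors *)

Section ConeMonoid.

Context (R : realType) (d : nat) (vs : seq 'rV[int]_d).
Hypothesis vs_uniq : uniq vs.
Context (pts : nat -> seq 'rV[int]_d).
Hypothesis pts_uniq : forall n, uniq (pts n).
Hypothesis mem_pts : forall n z, z \in pts n <-> cone R vs n z.
Hypothesis pts_span : forall (z : 'rV[int]_d) (k : int),
  exists b : 'rV[int]_d -> int,
    \sum_(p <- pts 1%N) b p = k /\ z = \sum_(p <- pts 1%N) b p *: p.

Local Notation T := (radius vs).
Implicit Types (m : 'X_{1..d.+1}) (z : 'rV[int]_d) (k n : nat).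

(* The last exponent is the height in the cone over the polytope; at height
   [k] the lattice points are shifted by [k * T] into the positive orthant. *)
Definition height m : nat := m ord_max.
Definition point m : 'rV[int]_d :=
  \row_j ((m (lift ord_max j))%:Z - (height m * T)%:Z).
Definition monom k z : 'X_{1..d.+1} :=
  [multinom if unlift ord_max i is Some j then absz (z 0 j + (k * T)%N%:Z)%R else k
     | i < d.+1].
Definition cone_mon : pred 'X_{1..d.+1} :=
  fun m => `[< cone R vs (height m) (point m) >].

Lemma heightD m m' : height (m + m')%MM = (height m + height m')%N.
Proof. by rewrite /height mnmDE. Qed.

Lemma heightMn m n : height (m *+ n)%MM = (height m * n)%N.
Proof. by rewrite /height mulmnE. Qed.

Lemma pointD m m' : point (m + m')%MM = point m + point m'.
Proof.
by apply/rowP => j; rewrite !mxE heightD mnmDE mulnDl !PoszD opprD addrACA.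
Qed.

Lemma point0 : point 0%MM = 0.
Proof. by apply/rowP => j; rewrite !mxE /height !mnm0E subrr. Qed.

Lemma pointMn m n : point (m *+ n)%MM = point m *+ n.
Proof.
by elim: n => [|n IH]; rewrite ?mulm0n ?point0 // mulmS pointD IH mulrS.
Qed.

Lemma height_monom k z : height (monom k z) = k.
Proof. by rewrite /height mnmE unlift_none. Qed.

Lemma point_monom k z : cone R vs k z -> point (monom k z) = z.
Proof.
move=> ckz; apply/rowP => j; rewrite mxE height_monom mnmE liftK.
by rewrite gez0_abs ?addrK //; apply: shift_ge0 ckz.
Qed.

Lemma monom_point m : monom (height m) (point m) = m.
Proof.
apply/mnmP => i; rewrite mnmE; case: unliftP => [j|] -> //.
by rewrite mxE subrK.
Qed.

Lemma point_inj m m' : height m = height m' -> point m = point m' -> m = m'.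
Proof. by move=> Eh Ep; rewrite -[m]monom_point -[m']monom_point Eh Ep. Qed.

Lemma cone_mon_monom k z : cone R vs k z -> cone_mon (monom k z).
Proof. by move=> ckz; apply/asboolP; rewrite height_monom point_monom. Qed.

Lemma cone_mon0 : cone_mon 0%MM.
Proof. by apply/asboolP; rewrite point0 /height mnm0E; apply: cone0. Qed.

Lemma cone_monD m m' : cone_mon m -> cone_mon m' -> cone_mon (m + m')%MM.
Proof.
move=> /asboolP c /asboolP c'; apply/asboolP.
by rewrite heightD pointD; apply: coneD.
Qed.

Lemma cone_mon_sat N m : (0 < N)%N -> cone_mon (m *+ N)%MM -> cone_mon m.
Proof.
move=> N0 /asboolP; rewrite heightMn pointMn => c; apply/asboolP.
exact: cone_sat N0 c.
Qed.

Definition mons n := [seq monom n z | z <- pts n].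

Lemma mons_uniq n : uniq (mons n).
Proof.
rewrite map_inj_in_uniq // => z z' /mem_pts c /mem_pts c' E.
by rewrite -(point_monom c) -(point_monom c') E.
Qed.

Lemma mem_mons n m : (m \in mons n) = cone_mon m && (height m == n).
Proof.
apply/mapP/andP => [[z /mem_pts c ->]|[/asboolP c /eqP <-]].
  by rewrite cone_mon_monom // height_monom.
by exists (point m); [apply/mem_pts | rewrite monom_point].
Qed.

Lemma cone_mon_split m : cone_mon m -> ((size vs).+1 <= height m)%N ->
  exists v m', [/\ cone_mon v, height v = 1%N, cone_mon m' & m = (v + m')%MM].
Proof.
move=> /asboolP c lt_m; have [v v_vs c'] := cone_split vs_uniq lt_m c.
have c1 : cone R vs 1 v by apply: cone1.
exists (monom 1 v), (monom (height m).-1 (point m - v)).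
rewrite !cone_mon_monom // height_monom; split=> //.
apply: point_inj; first by rewrite heightD !height_monom add1n prednK //; lia.
by rewrite pointD !point_monom // addrC subrK.
Qed.

Lemma cone_mon_bound m : cone_mon m ->
  forall i, (m i <= (2 * T).+1 * height m)%N.
Proof.
move=> /asboolP c i; case: (unliftP ord_max i) => [j|] ->.
  have := cone_bound j c; rewrite mxE ler_norml => /andP[_].
  rewrite lerBlDr -PoszD lez_nat => /leq_trans; apply.
  by rewrite mulSn -mulnA mul2n -addnn [(T * _)%N]mulnC leq_addl.
by rewrite /height leq_pmull.
Qed.

Lemma size_mons n : (size (mons n) <= 1 * ((2 * T).+1 * n.+1) ^ d)%N.
Proof.
rewrite size_map mul1n; apply: (@leq_trans (size (box vs n))).
  by apply: uniq_leq_size => // z /mem_pts/cone_box.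
by rewrite size_box; apply: leq_wexp2r; nia.
Qed.

Lemma sum_monom (ps : seq 'rV[int]_d) (c : 'rV[int]_d -> int) :
  {subset ps <= pts 1%N} -> (forall p, p \in pts 1%N -> 0 <= c p) ->
  let m := (\sum_(p <- ps) monom 1 p *+ absz (c p))%MM in
  [/\ cone_mon m, (height m)%:Z = \sum_(p <- ps) c p,
      point m = \sum_(p <- ps) c p *: p &
      exists2 s, {subset s <= mons 1} & m = (\sum_(v <- s) v)%MM].
Proof.
move=> sub c0 /=; have Cm1 p : p \in pts 1%N -> cone_mon (monom 1 p).
  by move=> /mem_pts; apply: cone_mon_monom.
elim: ps sub => [_|p s IH sub].
  rewrite !big_nil cone_mon0 point0 /height mnm0E; split=> //.
  by exists [::] => //; rewrite big_nil.
have p1 : p \in pts 1%N by apply: sub; apply: mem_head.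
have [|Cs Hs Ps [l ll El]] := IH; first by move=> u us; apply: sub; rewrite inE us orbT.
rewrite !big_cons; split.
- apply: cone_monD => //; elim: (absz _) => [|k IHk]; first by rewrite mulm0n cone_mon0.
  by rewrite mulmS; apply: cone_monD => //; apply: Cm1.
- by rewrite heightD PoszD Hs heightMn height_monom mul1n gez0_abs // c0.
- rewrite pointD Ps pointMn point_monom; last exact/mem_pts.
  by rewrite -scaler_nat natz gez0_abs // c0.
exists (nseq (absz (c p)) (monom 1 p) ++ l).
  move=> u; rewrite mem_cat => /orP[|/ll//]; rewrite mem_nseq => /andP[_ /eqP->].
  by rewrite mem_mons Cm1 // height_monom.
rewrite big_cat /= -El; congr (_ + _)%MM.
by elim: (absz _) => [|k IHk]; rewrite ?mulm0n /= ?big_nil // big_cons mulmS IHk.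
Qed.

(** By [pts_span] the finitely many elements of height at most [(size vs).+1] are integer
    combinations of points of height one. Adding [B] copies of every such point makes their
    coefficients nonnegative; the rest of [m] is already a sum of generators. *)
Lemma mons_conductor : exists w, cone_mon w /\ forall m, cone_mon m ->
  exists2 s, {subset s <= mons 1} & (w + m = \sum_(v <- s) v)%MM.
Proof.
have sub1 : {subset pts 1%N <= pts 1%N} by [].
have /choice[b bP] : forall m, exists b : 'rV[int]_d -> int,
    \sum_(p <- pts 1%N) b p = (height m)%:Z /\
    point m = \sum_(p <- pts 1%N) b p *: p by move=> m; apply: pts_span.
pose lows := low mons (size vs).+1.
pose B := (\sum_(m <- lows) \sum_(p <- pts 1) absz (b m p))%N.
have [Cw Hw Pw _] := @sum_monom (pts 1%N) (fun _ => B%:Z) sub1 (fun p _ => le0z_nat B).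
exists (\sum_(p <- pts 1%N) monom 1 p *+ absz B%:Z)%MM; split=> // m Cm.
have [e [mu [Ce le_e Em]]] :=
  monoid_decomp heightD mons_uniq mem_mons cone_mon_split Cm.
have [_ Hmu Pmu _] := @sum_monom (pts 1%N) (fun p => (mu (monom 1 p))%:Z) sub1
  (fun p _ => le0z_nat _).
have [He Pe] := bP e.
have c0 p : p \in pts 1%N -> 0 <= B%:Z + b e p + (mu (monom 1 p))%:Z.
  move=> p1; apply: addr_ge0 => //.
  have : (absz (b e p) <= B)%N.
    have e_low : e \in lows by rewrite (mem_low mem_mons) Ce.
    by rewrite /B (big_rem e) //= (big_rem p) //= -addnA leq_addr.
  by lia.
have [_ Hc Pc [s ss Es]] := sum_monom sub1 c0.
exists s => //; rewrite -Es Em big_map; apply: point_inj.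
  by apply/eqP; rewrite -eqz_nat !heightD !PoszD Hw Hc Hmu -He !big_split addrA.
rewrite !pointD Pw Pc Pmu Pe.
under [RHS]eq_bigr => p _ do rewrite !scalerDl.
by rewrite !big_split addrA.
Qed.

(** Each unit vector is an integer combination of the points with total weight zero. Adding [al] of
    them to [k * B] copies of every point keeps the coefficients nonnegative and embeds the
    exponents of degree [k] into a single height; the last exponent of [al] is slack. *)
Lemma mons_lower : exists2 M, (0 < M)%N &
  forall k, ('C(k + d, d) <= size (mons (k * M)))%N.
Proof.
have sub1 : {subset pts 1%N <= pts 1%N} by [].
have /choice[b bP] : forall j : 'I_d, exists b : 'rV[int]_d -> int,
    \sum_(p <- pts 1%N) b p = 0 /\
    delta_mx 0 j = \sum_(p <- pts 1%N) b p *: p by move=> j; apply: pts_span.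
pose B := (1 + \sum_(j < d) \sum_(p <- pts 1) absz (b j p))%N.
exists (B * size (pts 1))%N.
  rewrite muln_gt0 /= lt0n size_eq0; apply/eqP => pts0.
  by have [c []] := pts_span 0 1; rewrite pts0 big_nil.
move=> k; pose c (al : 'X_{1..d.+1}) p : int :=
  (k * B)%:Z + \sum_(j < d) (al (lift ord_max j))%:Z * b j p.
pose F al := (\sum_(p <- pts 1%N) monom 1 p *+ absz (c al p))%MM.
have FP al : mdeg al = k -> [/\ cone_mon (F al), height (F al) = (k * (B * size (pts 1)))%N &
    point (F al) = (\sum_(p <- pts 1%N) (k * B)%:Z *: p) +
                   \sum_(j < d) (al (lift ord_max j))%:Z *: delta_mx 0 j].
  move=> Eal; have c0 p : p \in pts 1%N -> 0 <= c al p.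
    move=> p1; rewrite /c -[\sum_(j < d) _]opprK subr_ge0.
    apply: le_trans (ler_norm _) _; rewrite normrN.
    apply: le_trans (ler_norm_sum _ _ _) _.
    apply: (@le_trans _ _ (\sum_(j < d) (al (lift ord_max j))%:Z * B%:Z)).
      apply: ler_sum => j _; rewrite normrM ger0_norm // ler_wpM2l //.
      rewrite -abszE lez_nat /B (bigD1 j) //= (big_rem p) //=; lia.
    rewrite -mulr_suml PoszM ler_wpM2r //.
    rewrite -Eal mdegE big_ord_recr /= PoszD -[leLHS]addr0 lerD //.
    rewrite -(big_morph Posz PoszD (erefl _)) lez_nat.
    by rewrite leq_eqVlt; apply/orP; left; apply/eqP; apply: eq_bigr => j _; congr (al _);
       apply: val_inj; rewrite /= /bump leqNgt ltn_ord.
  have [CF HF PF _] := sum_monom sub1 c0; split=> //.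
    apply/eqP; rewrite -eqz_nat HF big_split /= exchange_big /= [X in _ + X]big1 ?addr0.
      by rewrite big_const_seq count_predT iter_addr_0 -mulr_natr natz -PoszM mulnA.
    by move=> j _; rewrite -mulr_sumr; have [-> _] := bP j; rewrite mulr0.
  rewrite PF; under eq_bigr => p _ do rewrite scalerDl scaler_suml.
  rewrite big_split exchange_big /=; congr (_ + _); apply: eq_bigr => j _.
  have [_ ->] := bP j; rewrite scaler_sumr; apply: eq_bigr => p _.
  by rewrite scalerA.
rewrite -size_monomials -(size_map F); apply: uniq_leq_size.
  rewrite map_inj_in_uniq ?monomials_uniq // => al al'.
  rewrite !mem_monomials => /eqP Eal /eqP Eal' EF.
  have [_ _ P1] := FP _ Eal; have [_ _ P2] := FP _ Eal'.
  have Ej j : al (lift ord_max j) = al' (lift ord_max j).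
    have : point (F al) = point (F al') by rewrite EF.
    rewrite P1 P2 => /addrI /rowP/(_ j); rewrite !summxE.
    have sE (x : 'X_{1..d.+1}) :
        \sum_(i < d) ((x (lift ord_max i))%:Z *: delta_mx 0 i : 'rV[int]_d) 0 j
        = (x (lift ord_max j))%:Z.
      rewrite (bigD1 j) //= !mxE !eqxx mulr1 big1 ?addr0 // => i /negbTE ne.
      by rewrite !mxE eq_sym ne andbF mulr0.
    by rewrite !sE => -[].
  apply/mnmP => i; case: (unliftP ord_max i) => [j|] -> //.
  have split_deg (x : 'X_{1..d.+1}) :
      mdeg x = (x ord_max + \sum_(l < d.+1 | l != ord_max) x l)%N.
    by rewrite mdegE (bigD1 ord_max).
  move: Eal; rewrite -Eal' !split_deg (eq_bigr (fun l => al' l)) => [/addIn//|l].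
  by case: (unliftP ord_max l) => [j|] -> //; rewrite eqxx.
move=> m /mapP[al]; rewrite mem_monomials => /eqP Eal ->.
by have [CF HF _] := FP _ Eal; rewrite mem_mons CF HF eqxx.
Qed.

Lemma cone_hilbert : exists g : nat -> nat,
  (forall n, size (pts n) = \sum_(j < n.+1) g j * 'C(n - j + d, d))%N /\
  (forall m s : nat, (0 < m)%N -> g m = 0%N -> (m <= s)%N -> g s = 0%N).
Proof.
have [w [Cw cond]] := mons_conductor; have [M M0 low_M] := mons_lower.
have [g [gH gg]] := hilbert_no_gap heightD cone_mon0 cone_monD mons_uniq mem_mons
  cone_mon_split size_mons M0 low_M cone_mon_bound cone_mon_sat Cw cond.
by exists g; split=> // n; rewrite -gH size_map.
Qed.

End ConeMonoid.

(** * Conclusion for spanning polytopes *)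

Lemma affine_hull_span (d : nat) (A : set 'rV[int]_d) (ps : seq 'rV[int]_d) :
  uniq ps -> (forall p, p \in ps <-> A p) -> affine_hull A = [set: 'rV[int]_d]%classic ->
  forall (z : 'rV[int]_d) (k : int), exists b : 'rV[int]_d -> int,
    \sum_(p <- ps) b p = k /\ z = \sum_(p <- ps) b p *: p.
Proof.
move=> ups mem_ps hullT.
have aff (z : 'rV[int]_d) : exists b : 'rV[int]_d -> int,
    \sum_(p <- ps) b p = 1 /\ z = \sum_(p <- ps) b p *: p.
  have : affine_hull A z by rewrite hullT.
  move=> [n [p [a [pA sa ->]]]].
  exists (fun u => \sum_(i < n | p i == u) a i); split.
    under eq_bigr => u _ do rewrite big_mkcond.
    rewrite exchange_big -sa; apply: eq_bigr => i _ /=.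
    rewrite (bigD1_seq (p i)) //=; last exact/mem_ps.
    by rewrite eqxx big1 ?addr0 // => u; rewrite eq_sym => /negbTE->.
  under [RHS]eq_bigr => u _ do rewrite big_mkcond scaler_suml.
  rewrite exchange_big; apply: eq_bigr => i _ /=.
  rewrite (bigD1_seq (p i)) //=; last exact/mem_ps.
  rewrite eqxx big1 ?addr0 // => u; rewrite eq_sym => /negbTE->.
  by rewrite scale0r.
move=> z k; have [b [sb Eb]] := aff z; have [c [sc Ec]] := aff 0.
(* A combination for [z] has weight 1; adding [k - 1] times one for the origin corrects the weight
   to [k]. *)
exists (fun p => b p + (k - 1) * c p); split.
  by rewrite big_split /= -mulr_sumr sb sc mulr1 addrC subrK.
under eq_bigr => p _ do rewrite scalerDl -scalerA.
by rewrite big_split /= -scaler_sumr -Ec scaler0 addr0.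
Qed.

Theorem theorem1p3 (R : realType) (d : nat) (P : set 'rV[R]_d) (h : {poly int})
  (P_lattice : lattice_polytope P) (P_dim : full_dimensional P)
  (P_spanning : spanning P) (h_hstar : is_hstar P h) :
  forall i : nat, (i <= (size h).-1)%N -> 1 <= h`_i.
Proof.
have [V [finV EP]] := P_lattice.
pose vs : seq 'rV[int]_d := fset_set V.
have vs_uniq : uniq vs by apply: fset_uniq.
have mem_vs v : v \in vs <-> V v.
  by rewrite /vs in_fset_set // inE.
have vs0 : vs != [::].
  (* Full dimension excludes the empty polytope: weights with sum 1 require a point of [P], and that
     in turn a point of [V]. *)
  apply/eqP => vs0; have : affine_hull P 0 by rewrite P_dim.
  move=> [n [p [a [pP sa _]]]]; case: n p a pP sa => [|n] p a pP sa.
    by move: sa; rewrite big_ord0 => /esym/eqP; rewrite oner_eq0.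
  have := pP ord0; rewrite EP => -[l [q [c [qV _ sc _]]]].
  case: l q c qV sc => [|l] q c qV sc.
    by move: sc; rewrite big_ord0 => /esym/eqP; rewrite oner_eq0.
  by have [v /mem_vs] := qV ord0; rewrite vs0.
have lpE k z : lattice_points (dilate k P) z <-> cone R vs k z.
  exact: lattice_points_dilate vs_uniq mem_vs vs0 EP.
have lpS k : lattice_points (dilate k P) = [set z | cone R vs k z]%classic.
  by apply/seteqP; split=> z /lpE.
pose pts n : seq 'rV[int]_d := fset_set (lattice_points (dilate n P)).
have pts_uniq n : uniq (pts n) by apply: fset_uniq.
have mem_pts n z : z \in pts n <-> cone R vs n z.
  rewrite /pts in_fset_set; last by rewrite lpS; apply: finite_cone.
  by rewrite inE; apply: lpE.
have dil1 : dilate 1 P = P.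
  apply/seteqP; split=> [x [y Py <-]|x Px]; first by rewrite scale1r.
  by exists x => //; rewrite scale1r.
have pts1 z : z \in pts 1%N <-> lattice_points P z.
  by rewrite -[in X in _ <-> X]dil1 lpE; apply: mem_pts.
have pts_span := affine_hull_span (pts_uniq 1%N) pts1 P_spanning.
have [g [gH g_gap]] := cone_hilbert vs_uniq pts_uniq mem_pts pts_span.
have hg n : h`_n = (g n)%:Z.
  rewrite h_hstar; apply: (@hilbert_numerator d (fun j => (g j)%:Z)
    (fun k => (ehrhart P k)%:R)) => {}n.
  rewrite natz -[ehrhart P n]/(size (pts n)) gH.
  rewrite (big_morph Posz PoszD (erefl _)); apply: eq_bigr => j _.
  by rewrite PoszM natz.
have g0 : (0 < g 0%N)%N.
  have := gH 0%N; rewrite big_ord1 subn0 add0n binn muln1 => <-.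
  rewrite lt0n size_eq0; have : 0 \in pts 0%N by apply/mem_pts; apply: cone0.
  by case: (pts 0%N).
have h0 : h != 0.
  by apply: contraTneq g0 => h0; have := hg 0%N; rewrite h0 coef0 => -[<-].
(* A zero [g i] with [i > 0] would propagate to the degree of [h] and kill its leading
   coefficient. *)
move=> i le_i; rewrite hg lez_nat lt0n; apply/eqP => gi0.
have i0 : (0 < i)%N by rewrite lt0n; apply: contraTneq g0 => i0; rewrite -i0 gi0.
have /eqP : lead_coef h = 0 by rewrite lead_coefE hg (g_gap _ _ i0 gi0 le_i).
by rewrite lead_coef_eq0 (negbTE h0).
Qed.
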